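(* The optimal mechanism $(q_{RS}^*,m_{RS}^* )$ of the robust satisficing problem $$\inf_{(q,m)\in\mathcal M,\ k>0}k\quad\text{s.t.}\quad\tau-\mathbb E_P[m(\tilde v)]\le k\,d(P,P_0)\quad\forall P\in\mathcal P$$ is given as follows: for each $j=0,1,\dots,J^*$, $$\left(q_{RS}^*(v),m_{RS}^*(v)\right)=\begin{cases}k_{RS}^*\cdot\left(\sum_{i\in[j-1]}\ln\frac{w_i^*}{u_i^*}+\ln\frac{v}{u_j^*},\ \sum_{i\in[j-1]}(w_i^*-u_i^* )+(v-u_j^* )\right), & v\in[u_j^*,w_j^* ),\\[2mm] k_{RS}^*\cdot\left(\sum_{i\in[j]}\ln\frac{w_i^*}{u_i^*},\ \sum_{i\in[j]}(w_i^*-u_i^* )\right), & v\in[w_j^*,u_{j+1}^* ),\end{cases}$$ and $\left(q_{RS}^*(1),m_{RS}^*(1)\right)=\left(1,\ k_{RS}^*\sum_{i\in[J^*]}(w_i^*-u_i^* )\right)$, where $k_{RS}^*=(\rho^* )^{-1}(\tau)$, $\pi^*=\pi^*(k_{RS}^* )$, $J^*=J(\pi^* )$, and $u_j^*=u_j(\pi^* )$, $w_j^*=w_j(\pi^* )$ for all $j\in[J^*]$.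
   Context: $\mathcal P$ is the set of all probability distributions supported on $[0,1]$; $\bar P(x)=1-P(x)$. $P_0\in\mathcal P$ is a fixed reference distribution; $\tilde v\sim P$ under $\mathbb E_P$; $d(P,P_0)=\int_0^1|\bar P(x)-\bar P_0(x)|\,\mathrm dx$. The set of direct mechanisms is $$\mathcal M=\left\{(q,m):[0,1]\to[0,1]\times\mathbb R\ :\ q \text{ non-decreasing},\ m(v)=\int_0^v x\,\mathrm dq(x)\ \forall v\in[0,1]\right\},$$ where the (Riemann–Stieltjes) integral equals $v q(v)-\int_0^v q(x)\,\mathrm dx$. $\Pi_0:=\max_{x\in[0,1]}x\,\mathbb P_{P_0}(\tilde v\ge x)$. For $\pi\in[0,\Pi_0]$, $d(\pi):=\int_0^1(\bar P_0(x)-\pi/x)^+\,\mathrm dx$. $\rho(\pi,k):=\pi+k\,d(\pi)$, $\rho^*(k):=\min_{\pi\in[0,\Pi_0]}\rho(\pi,k)$, $\pi^*(k):=\arg\min_{\pi\in[0,\Pi_0]}\rho(\pi,k)$. The target $\tau\in(0,\Pi_0]$ is in the range of $\rho^*$, and $(\rho^* )^{-1}(\tau)$ is the $k>0$ with $\rho^*(k)=\tau$. Standing assumption: for every $\pi\in[0,\Pi_0]$ there exist an integer $J(\pi)\ge0$ and numbers $0\le u_1(\pi)<w_1(\pi)<u_2(\pi)<\dots<u_{J(\pi)}(\pi)<w_{J(\pi)}(\pi)\le1$ such that $\{x\in(0,1):\bar P_0(x)>\pi/x\}$ coincides, up to finitely many points, with $\bigcup_j(u_j(\pi),w_j(\pi))$,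 and $\bar P_0(x)\ge\pi/x$ on $\bigcup_j[u_j(\pi),w_j(\pi))$. Conventions: $[N]=\{1,\dots,N\}$, empty sums are $0$, $u_0^*=w_0^*=0$, $u_{J^*+1}^*=1$.
   Formalization: It is additionally assumed that the set of x in (0,1) with P̄_0(x) = π*/x is Lebesgue-null; without this the stated formula need not define a mechanism (m(1) can differ from the integral of x dq* ), so the claim fails. *)

(* Defs.v *)
(* MathComp / MathComp-Analysis. *)
From HB Require Import structures.
From mathcomp Require Import all_boot all_order all_algebra.
From mathcomp Require Import all_classical all_reals all_analysis.

Set Implicit Arguments.
Unset Strict Implicit.
Unset Printing Implicit Defensive.

Import Order.TTheory GRing.Theory Num.Theory.
Import numFieldNormedType.Exports.

Local Open Scope classical_set_scope.
Local Open Scope ring_scope.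

(* Distributions on [0,1] are probability measures on the line carried by
   [0,1]; functions on [0,1] are functions R -> R, used on [0,1] only. *)
Definition supported01 (R : realType) (P : probability (measurableTypeR R) R) :
    Prop :=
  P `[0, 1]%classic = 1%E.

Definition Pbar (R : realType) (P : probability (measurableTypeR R) R) (x : R) :
    R :=
  1 - fine (P `]-oo, x]%classic).

Definition dist (R : realType) (P P0 : probability (measurableTypeR R) R) : R :=
  Rintegral (@lebesgue_measure R) `[0, 1]%classic
    (fun x => `|Pbar P x - Pbar P0 x|).

(* E_P[m(v)]; P is carried by [0,1]. *)
Definition revenue (R : realType) (P : probability (measurableTypeR R) R)
    (m : R -> R) : R :=
  Rintegral P `[0, 1]%classic m.

(* v q(v) - \int_0^v q is the Riemann-Stieltjes integral \int_0^v x dq(x). *)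
Definition mechanism (R : realType) (q m : R -> R) : Prop :=
  [/\ forall v : R, v \in `[0, 1] -> 0 <= q v <= 1,
      {in `[0, 1] &, {homo q : x y / x <= y}} &
      forall v : R, v \in `[0, 1] ->
        m v = v * q v - Rintegral (@lebesgue_measure R) `[0, v]%classic q].

Definition RS_feasible (R : realType) (P0 : probability (measurableTypeR R) R)
    (tau : R) (q m : R -> R) (k : R) : Prop :=
  [/\ mechanism q m, 0 < k &
      forall P : probability (measurableTypeR R) R, supported01 P ->
        tau - revenue P m <= k * dist P P0].

Definition RS_optimal (R : realType) (P0 : probability (measurableTypeR R) R)
    (tau : R) (q m : R -> R) (k : R) : Prop :=
  RS_feasible P0 tau q m k /\
  forall (q' m' : R -> R) (k' : R), RS_feasible P0 tau q' m' k' -> k <= k'.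

(* The supremum is attained: x |-> P0[x, +oo[ is left-continuous and
   non-increasing. *)
Definition Pi0 (R : realType) (P0 : probability (measurableTypeR R) R) : R :=
  sup [set x * fine (P0 `[x, +oo[%classic) | x in `[0, 1]%classic].

(* The integrand at x = 0, where pi / 0 = 0, is irrelevant. *)
Definition dpi (R : realType) (P0 : probability (measurableTypeR R) R)
    (pi : R) : R :=
  Rintegral (@lebesgue_measure R) `[0, 1]%classic
    (fun x => Num.max (Pbar P0 x - pi / x) 0).

Definition rho (R : realType) (P0 : probability (measurableTypeR R) R)
    (pi k : R) : R :=
  pi + k * dpi P0 pi.

(* The infimum is attained: rho is continuous in pi. *)
Definition rho_star (R : realType) (P0 : probability (measurableTypeR R) R)
    (k : R) : R :=
  inf [set rho P0 pi k | pi in `[0, Pi0 P0]%classic].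

Definition is_argmin_rho (R : realType)
    (P0 : probability (measurableTypeR R) R) (k pi : R) : Prop :=
  pi \in `[0, Pi0 P0] /\
  forall pi' : R, pi' \in `[0, Pi0 P0] -> rho P0 pi k <= rho P0 pi' k.

(* u and w are indexed by 1, ..., J; other indices are ignored. *)
Definition level_intervals (R : realType)
    (P0 : probability (measurableTypeR R) R) (pi : R)
    (J : nat) (u w : nat -> R) : Prop :=
  let A := [set x : R | 0 < x < 1 /\ Pbar P0 x > pi / x] in
  let U := [set x : R | exists2 j : nat, (1 <= j <= J)%N & u j < x < w j] in
  [/\ forall j : nat, (1 <= j <= J)%N -> [/\ 0 <= u j, u j < w j & w j <= 1],
      forall j : nat, (1 <= j < J)%N -> w j < u j.+1,
      finite_set ((A `\` U) `|` (U `\` A)) &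
      forall (j : nat) (x : R), (1 <= j <= J)%N -> u j <= x < w j ->
        Pbar P0 x >= pi / x].

(* Conventions u_0 = w_0 = 0 and u_{J+1} = 1. *)
Definition uext (R : realType) (J : nat) (u : nat -> R) (j : nat) : R :=
  if j == 0%N then 0 else if (j <= J)%N then u j else 1.

Definition wext (R : realType) (w : nat -> R) (j : nat) : R :=
  if j == 0%N then 0 else w j.

(* (q, m) is, on [0,1], the piecewise logarithmic / linear pair attached to
   the slope k and the intervals [u_j, w_j). *)
Definition RS_form (R : realType) (k : R) (J : nat) (u w : nat -> R)
    (q m : R -> R) : Prop :=
  (forall j : nat, (j <= J)%N ->
    (forall v : R, uext J u j <= v < wext w j ->
       (q v, m v) =
       (k * (\sum_(1 <= i < j) ln (w i / u i) + ln (v / uext J u j)),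
        k * (\sum_(1 <= i < j) (w i - u i) + (v - uext J u j)))) /\
    (forall v : R, wext w j <= v < uext J u j.+1 ->
       (q v, m v) =
       (k * \sum_(1 <= i < j.+1) ln (w i / u i),
        k * \sum_(1 <= i < j.+1) (w i - u i)))) /\
  (q 1, m 1) = (1, k * \sum_(1 <= i < J.+1) (w i - u i)).

(* Main.v *)
Require Import Defs.
From HB Require Import structures.
From mathcomp Require Import all_boot all_order all_algebra.
From mathcomp Require Import all_classical all_reals all_analysis.
From mathcomp Require Import measurable_realfun ring lra.

Set Implicit Arguments.
Unset Strict Implicit.
Unset Printing Implicit Defensive.

Import Order.TTheory GRing.Theory Num.Theory.
Import numFieldNormedType.Exports.

Local Open Scope classical_set_scope.
Local Open Scope ring_scope.

(** Write [p0] for the survival function [Pbar P0], [d] for [dpi P0], [s] for the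
    minimizer [pis], and [e_s x = s / max x s] for the equal-revenue survival function, against
    which every price earns at most [s].  Let [A] be the set where [e_s < p0].

    Testing a feasible mechanism against the law with survival function
    [min p0 e_s] shows [tau <= s + k d(s)]: no mechanism earns more than [s]
    from that law ([capped_revenue_le]), and its distance to [P0] is [d(s)].
    Since [tau = s + kRS d(s)] and [d(s) > 0], this gives [kRS <= k]
    ([feasible_le], [dpi_gt0]).

    Because the level set [p0 = s / x] is null, [d] is differentiable at [s] with
    derivative [- \int_A dx / x] (dominated convergence, [shortfall_slope]); [s]
    is an interior minimizer, as [d] has infinite slope at [0] ([argmin_gt0]), so
    [kRS \int_A dx / x = 1] ([argmin_first_order]).  Hence
    [q v = kRS \int_(A, x <= v) dx / x] ends at [1]; it is a mechanism whose
    payment is [m v = kRS |A \cap [0, v]|], its revenue under [P] is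
    [kRS \int_A Pbar P], and the robust constraint reduces to
    [\int_A (p0 - Pbar P) <= d(P, P0)] ([sale_mechanism_feasible]).

    For uniqueness, raise the equal-revenue level from [s] to [s + e] below a
    point [t] only, or above [t] only, and let [e] tend to [0].  The first test
    forces [q t >= kRS \int_(A, x <= t) dx / x], the second the opposite
    inequality ([optimal_ge], [optimal_le]), so [q], and with it [m], is
    determined at every point of [0, 1].  As [A] is a finite union of intervals
    up to finitely many points, the two integrals are the stated sums of
    logarithms and lengths ([RS_formP]).

    Integrals against [dq], layer-cake formulas and integrals of [1 / x] are all
    obtained from one device, [bisection_le]: an increment bounded by
    [(y - x) (g y - g x)] on all subintervals is nonpositive, whatever [g]. *)

(** * Bisection and integrals over intervals *)

(** Cutting [[a, b]] into [2 ^ n] equal pieces bounds [F b - F a] by the mesh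
    [(b - a) / 2 ^ n] times the telescoping sum [g b - g a]. *)
Lemma bisection_le (R : realType) (F g : R -> R) (a b : R) :
  a <= b ->
  (forall x y, a <= x -> x <= y -> y <= b -> F y - F x <= (y - x) * (g y - g x)) ->
  F b <= F a.
Proof.
move=> ab H.
have Hn n x y : a <= x -> x <= y -> y <= b ->
    F y - F x <= (y - x) / 2 ^+ n * (g y - g x).
  elim: n x y => [|n IH] x y ax xy yb; first by rewrite expr0 divr1 H.
  have e2 : 2 ^+ n != 0 :> R by rewrite expf_neq0.
  have h1 := IH x ((x + y) / 2) ax ltac:(lra) ltac:(lra).
  have h2 := IH ((x + y) / 2) y ltac:(lra) ltac:(lra) yb.
  have E1 : (x + y) / 2 - x = (y - x) / 2 by lra.
  have E2 : y - (x + y) / 2 = (y - x) / 2 by lra.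
  rewrite E1 in h1; rewrite E2 in h2.
  have -> : (y - x) / 2 ^+ n.+1 = (y - x) / 2 / 2 ^+ n.
    by rewrite exprS; field.
  by set z := _ / 2 ^+ n in h1 h2 *; lra.
rewrite leNgt; apply/negP => ltF.
pose c := F b - F a; pose D := (b - a) * (g b - g a).
have c0 : 0 < c by rewrite /c subr_gt0.
pose n := Num.bound (D / c).
have := Hn n a b (lexx _) ab (lexx _).
rewrite -/c mulrAC -/D; apply/negP; rewrite -ltNge ltr_pdivrMr ?exprn_gt0//.
have [D0|D0] := ltP D 0; first by rewrite (lt_le_trans D0)// mulr_ge0 ?exprn_ge0// ltW.
rewrite mulrC -ltr_pdivrMr//.
apply: (lt_le_trans (archi_boundP _)); first by rewrite divr_ge0 // ltW.
by rewrite -natrX ler_nat ltnW // ltn_expl.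
Qed.

Lemma bisection_eq (R : realType) (F g : R -> R) (a b : R) :
  a <= b ->
  (forall x y, a <= x -> x <= y -> y <= b ->
     `|F y - F x| <= (y - x) * (g y - g x)) ->
  F b = F a.
Proof.
move=> ab H; apply/eqP; rewrite eq_le; apply/andP; split.
  apply: (bisection_le (g := g)) => // x y ax xy yb.
  exact: le_trans (ler_norm _) (H _ _ ax xy yb).
rewrite -lerN2; apply: (bisection_le (F := \- F) (g := g)) => // x y ax xy yb.
apply: le_trans (H _ _ ax xy yb); rewrite -normrN opprB /= opprK addrC.
exact: ler_norm.
Qed.

Lemma bounded_integrable d (T : measurableType d) (R : realType)
    (mu : {measure set T -> \bar R}) (D : set T) (f : T -> R) (M : R) :
  measurable D -> (mu D < +oo)%E -> measurable_fun D f ->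
  (forall x, D x -> `|f x| <= M) -> mu.-integrable D (EFin \o f).
Proof.
move=> mD muD mf fM; apply: measurable_bounded_integrable => //.
by exists M; split; [exact: num_real|move=> N MN x Dx; apply: le_trans (fM _ Dx) (ltW MN)].
Qed.

Section interval_integrals.
Context {R : realType}.
Notation leb := (@lebesgue_measure R).
Implicit Types (f : R -> R) (a b c : R).

Lemma lebesgue_itvcc_lty a b : (leb `[a, b]%classic < +oo)%E.
Proof. by rewrite lebesgue_measure_itv /=; case: ifP => _; rewrite ?ltry// -EFinB ltry. Qed.

Lemma bounded_integrable_itv f a b M : measurable_fun `[a, b]%classic f ->
  (forall x, a <= x <= b -> `|f x| <= M) ->
  leb.-integrable `[a, b]%classic (EFin \o f).
Proof.
move=> mf fM; apply: (@bounded_integrable _ _ _ leb _ f M) => //.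
exact: lebesgue_itvcc_lty.
Qed.

Lemma Rintegral_itv_split f a b c : a <= b -> b <= c ->
  leb.-integrable `[a, c]%classic (EFin \o f) ->
  Rintegral leb `[a, c]%classic f - Rintegral leb `[a, b]%classic f =
  Rintegral leb `[b, c]%classic f.
Proof.
move=> ab bc fi.
have := @Rintegral_itvB R f (BLeft a) (BRight c) b fi.
rewrite !bnd_simp => /(_ ab bc) ->.
apply: Rintegral_itv_obnd_cbnd; apply: integrableS fi => //.
by apply: subset_itvr; rewrite bnd_simp.
Qed.

Lemma Rintegral_itv_cst a b c : a <= b ->
  Rintegral leb `[a, b]%classic (fun=> c) = c * (b - a).
Proof.
move=> ab; rewrite Rintegral_cst//= lebesgue_measure_itv /= lte_fin.
by case: ltgtP ab => // -> _; rewrite subrr.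
Qed.

Lemma Rintegral_itv_bounds f a b l r : a <= b ->
  leb.-integrable `[a, b]%classic (EFin \o f) ->
  (forall x, a <= x <= b -> l <= f x <= r) ->
  l * (b - a) <= Rintegral leb `[a, b]%classic f <= r * (b - a).
Proof.
move=> ab fi H; have ci t : leb.-integrable `[a, b]%classic (EFin \o cst t).
  apply: (@bounded_integrable_itv _ _ _ `|t|) => //.
apply/andP; split; rewrite -Rintegral_itv_cst//; apply: le_Rintegral => //;
  by [exact: ci | move=> x /=; rewrite in_itv /= => /H /andP[]].
Qed.

Lemma clamp_itv a b x : a <= b -> a <= Num.max a (Num.min x b) <= b.
Proof. by move=> ab; rewrite le_max lexx /= ge_max ab ge_min lexx orbT. Qed.

Lemma clamp_id a b x : a <= x <= b -> Num.max a (Num.min x b) = x.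
Proof. by case/andP=> ax xb; rewrite min_l// max_r. Qed.

Lemma homo_measurable_itv f a b :
  {in `[a, b] &, {homo f : x y / x <= y}} -> measurable_fun `[a, b]%classic f.
Proof.
move=> fh; have [ab|ba] := leP a b; last first.
  by rewrite set_itv_ge ?bnd_simp -?ltNge//; exact: measurable_fun_set0.
apply: (eq_measurable_fun (f \o (fun x => Num.max a (Num.min x b)))).
  by move=> x; rewrite inE /= in_itv /= => /clamp_id ->.
apply: nondecreasing_measurable => // x y xy /=.
apply: fh; rewrite ?in_itv /= ?clamp_itv//.
by rewrite le_max2// le_min2.
Qed.

Lemma homo_integrable_itv f a b :
  {in `[a, b] &, {homo f : x y / x <= y}} ->
  leb.-integrable `[a, b]%classic (EFin \o f).
Proof.
move=> fh; apply: (@bounded_integrable_itv _ _ _ (`|f a| + `|f b|)).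
  exact: homo_measurable_itv.
move=> x /andP[ax xb]; have ab := le_trans ax xb.
have h1 : f a <= f x by apply: fh; rewrite ?in_itv /= ?lexx ?ax ?xb ?ab.
have h2 : f x <= f b by apply: fh; rewrite ?in_itv /= ?lexx ?ax ?xb ?ab.
have := ler_norm (f b); have := ler_norm (- f a); rewrite normrN => h3 h4.
rewrite ler_norml; have := normr_ge0 (f a); have := normr_ge0 (f b).
by move=> *; apply/andP; split; lra.
Qed.

End interval_integrals.

(** * Survival functions *)

Section survival_function.
Context {R : realType}.
Implicit Types (P : probability (measurableTypeR R) R) (x y : R).

Let mle x : measurable (`]-oo, x]%classic : set (measurableTypeR R)).
Proof. exact: measurable_itv. Qed.

Lemma fine_probability_le P (A B : set (measurableTypeR R)) :
  measurable A -> measurable B -> A `<=` B -> fine (P A) <= fine (P B).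
Proof.
by move=> mA mB AB; rewrite fine_le ?fin_num_measure// le_measure ?inE.
Qed.

Lemma fine_probability_01 P (A : set (measurableTypeR R)) :
  measurable A -> 0 <= fine (P A) <= 1.
Proof.
move=> mA; rewrite fine_ge0//=.
by rewrite -lee_fin fineK ?fin_num_measure// probability_le1.
Qed.

Lemma Pbar_noninc P x y : x <= y -> Pbar P y <= Pbar P x.
Proof.
move=> xy; rewrite lerB// fine_probability_le//.
by apply: subset_itvl; rewrite bnd_simp.
Qed.

Lemma Pbar_ge0 P x : 0 <= Pbar P x.
Proof. by rewrite subr_ge0; have /andP[] := fine_probability_01 P (mle x). Qed.

Lemma Pbar_le1 P x : Pbar P x <= 1.
Proof. by rewrite gerBl; have /andP[] := fine_probability_01 P (mle x). Qed.

Lemma Pbar_itv P x : Pbar P x = fine (P `]x, +oo[%classic).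
Proof.
rewrite /Pbar -setCitvl probability_setC//.
by rewrite fineB ?fin_num_measure.
Qed.

Lemma Pbar_ge1 P x : supported01 P -> 1 <= x -> Pbar P x = 0.
Proof.
move=> P01 x1; apply/eqP; rewrite eq_le Pbar_ge0 andbT subr_le0.
have -> : 1 = fine (P `[0, 1]%classic) by rewrite P01.
apply: fine_probability_le => // y /=; rewrite !in_itv /= => /andP[_ y1].
exact: le_trans y1 x1.
Qed.

Lemma Pbar_lt0 P x : supported01 P -> x < 0 -> Pbar P x = 1.
Proof.
move=> P01 x0; apply/eqP; rewrite eq_le Pbar_le1 Pbar_itv /=.
have -> : 1 = fine (P `[0, 1]%classic) by rewrite P01.
apply: fine_probability_le => // y /=; rewrite !in_itv /= => /andP[y0 _].
by rewrite (lt_le_trans x0 y0).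
Qed.

Lemma Pbar_measurable P (D : set R) : measurable D -> measurable_fun D (Pbar P).
Proof.
by move=> mD; apply: nonincreasing_measurable => // x y; exact: Pbar_noninc.
Qed.

Let idR : measurableTypeR R -> R := idfun.

#[local] HB.instance Definition _ :=
  @isMeasurableFun.Build _ _ _ _ idR (@measurable_id _ _ setT).

Lemma Pbar_right_continuous P : right_continuous (Pbar P).
Proof.
move=> x; apply: cvgB; first exact: cvg_cst.
apply: fine_cvg; rewrite fineK ?fin_num_measure//.
exact: (@cdf_right_continuous _ _ _ P (idR : {RV P >-> R})).
Qed.

Section law_of_survival_function.
Context (s : R -> R).
Context (s_noninc : {homo s : x y / x <= y >-> y <= x}).
Context (s_rc : right_continuous s).
Context (s_lt0 : forall x, x < 0 -> s x = 1).
Context (s_ge1 : forall x, 1 <= x -> s x = 0).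

Let F x := 1 - s x.

Let F_nd : nondecreasing F.
Proof. by move=> x y xy; rewrite lerB// s_noninc. Qed.

Let F_rc : right_continuous F.
Proof. by move=> x; apply: cvgB; [exact: cvg_cst|exact: s_rc]. Qed.

#[local] HB.instance Definition _ := isCumulative.Build R _ R F F_nd F_rc.

Let F_Ny : F @ -oo --> (0 : R).
Proof.
apply: cvg_near_cst; near=> x; rewrite /F s_lt0 ?subrr//.
Unshelve. all: by end_near. Qed.

Let F_y : F @ +oo --> (1 : R).
Proof.
apply: cvg_near_cst; near=> x; rewrite /F s_ge1 ?subr0//.
Unshelve. all: by end_near. Qed.

#[local] HB.instance Definition _ :=
  isCumulativeBounded.Build R 0 1 F F_Ny F_y.

(** The law is the Lebesgue-Stieltjes measure of [1 - s]. *)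
Lemma survival_function_law :
  exists2 P, supported01 P & forall x, Pbar P x = s x.
Proof.
pose P : probability (measurableTypeR R) R := lebesgue_stieltjes_measure F.
have PF x : P `]-oo, x]%classic = (F x)%:E.
  exact: cdf_lebesgue_stieltjes_id.
have Ps x : Pbar P x = s x by rewrite /Pbar PF /= /F subKr.
exists P => //.
have P0 : P `]-oo, 0[%classic = 0%E.
(* [1 - s] may jump at [0], so ]-oo, 0[ has to be exhausted from inside. *)
  have -> : `]-oo, 0[%classic =
      \bigcup_n (`]-oo, - n.+1%:R^-1]%classic : set (measurableTypeR R)).
    apply/seteqP; split=> x /=; rewrite in_itv /=; last first.
      by case=> n _ /=; rewrite in_itv /= => /le_lt_trans -> //; rewrite oppr_lt0.
    move=> x0; exists (Num.bound (- x)^-1) => //=.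
    rewrite in_itv /= lerNr -[leRHS]invrK lef_pV2 ?posrE ?invr_gt0 ?oppr_gt0//.
    apply: ltW; apply: (lt_le_trans (archi_boundP _)); last by rewrite ler_nat.
    by rewrite invr_ge0 oppr_ge0 ltW.
  apply: measure_negligible; first exact: bigcup_measurable.
  apply: negligible_bigcup => n; apply/negligibleP => //.
  by rewrite [LHS]PF /F s_lt0 ?oppr_lt0// subrr.
have U01 : (`]-oo, 0[ `|` `[0, 1] = `]-oo, (1 : R)])%classic.
  by rewrite -itv_bndbnd_setU ?bnd_simp//.
have := PF 1; rewrite -U01 measureU//.
  by rewrite [X in (X + _)%E]P0 add0e /F s_ge1// subr0.
by apply/seteqP; split=> // x [/=]; rewrite !in_itv /= ltNge => /negP h /andP[].
Qed.

End law_of_survival_function.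
End survival_function.

(** * Mechanisms and their revenue *)

Section mechanisms.
Context {R : realType}.
Notation leb := (@lebesgue_measure R).
Implicit Types (q m : R -> R) (x y : R).

(** The payment rule is equivalent to incentive compatibility: raising the type
    from [x] to [y] raises the payment by between [x] and [y] times the gain in
    allocation.  This form never mentions an integral of [q], so arbitrary
    jumps of [q] need no separate treatment. *)
Lemma mechanismP q m : mechanism q m <->
  [/\ forall v, v \in `[0, 1] -> 0 <= q v <= 1,
      {in `[0, 1] &, {homo q : x y / x <= y}},
      m 0 = 0 &
      forall x y, 0 <= x -> x <= y -> y <= 1 ->
        x * (q y - q x) <= m y - m x <= y * (q y - q x)].
Proof.
have qint q' x y : {in `[0, 1] &, {homo q' : x y / x <= y}} -> 0 <= x ->
    y <= 1 -> leb.-integrable `[x, y]%classic (EFin \o q').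
  move=> qh x0 y1; apply: homo_integrable_itv => s t.
  rewrite !in_itv /= => /andP[xs sy] /andP[xt ty]; apply: qh; rewrite in_itv /=.
    by rewrite (le_trans x0)//= (le_trans sy).
  by rewrite (le_trans x0)//= (le_trans ty).
have qbnd q' x y : {in `[0, 1] &, {homo q' : x y / x <= y}} -> 0 <= x ->
    x <= y -> y <= 1 ->
    q' x * (y - x) <= Rintegral leb `[x, y]%classic q' <= q' y * (y - x).
  move=> qh x0 xy y1; apply: Rintegral_itv_bounds => // [|z /andP[xz zy]].
    exact: qint.
  by apply/andP; split; apply: qh => //; rewrite in_itv /=; apply/andP; split; lra.
split=> [[q01 qh mE]|[q01 qh m0 mincr]].
  split=> // [|x y x0 xy y1].
    by rewrite mE ?in_itv /= ?lexx ?ler01// mul0r set_itv1 Rintegral_set1 subr0.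
  rewrite !mE ?in_itv /=; try (by apply/andP; split; lra).
  have := Rintegral_itv_split x0 xy (qint q 0 y qh (lexx _) y1).
  have /andP[] := qbnd q x y qh x0 xy y1.
  move: (Rintegral leb `[x, y]%classic q) (Rintegral leb `[0, x]%classic q)
    (Rintegral leb `[0, y]%classic q) => a b c h1 h2 h3.
  by apply/andP; split; nra.
split=> // v; rewrite in_itv /= => /andP[v0 v1].
pose F x := x * q x - m x - Rintegral leb `[0, x]%classic q.
suff : F v = F 0.
  by rewrite /F mul0r m0 set_itv1 Rintegral_set1; lra.
apply: (bisection_eq (g := q)) => // x y x0 xy yv; have y1 := le_trans yv v1.
have := Rintegral_itv_split x0 xy (qint q 0 y qh (lexx _) y1).
have /andP[] := qbnd q x y qh x0 xy y1.
have /andP[] := mincr x y x0 xy y1; rewrite /F.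
move: (Rintegral leb `[x, y]%classic q) (Rintegral leb `[0, x]%classic q)
    (Rintegral leb `[0, y]%classic q) => a b c h1 h2 h3 h4 h5.
by rewrite ler_norml; apply/andP; split; nra.
Qed.

Lemma mechanism_homo q m : mechanism q m ->
  {in `[0, 1] &, {homo m : x y / x <= y}}.
Proof.
move=> /mechanismP[_ qh _ mincr] x y; rewrite !in_itv /= => /andP[x0 x1] /andP[y0 y1] xy.
have /andP[h _] := mincr x y x0 xy y1.
rewrite -subr_ge0; apply: (le_trans _ h); rewrite mulr_ge0// subr_ge0 qh ?in_itv /= ?x0 ?y0//.
Qed.

End mechanisms.

Section revenue.
Context {R : realType}.
Context (P : probability (measurableTypeR R) R).
Context (P01 : supported01 P).
Implicit Types (q m : R -> R) (x y : R).

(** Revenue when types above [x] pay as type [x]; as a function of [x] it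
    splits the revenue of [m] into contributions of price ranges. *)
Definition capped_revenue m x := Rintegral P `[0, 1]%classic (fun v : R => m (Num.min v x)).

Lemma capped_revenue0 m : m 0 = 0 -> capped_revenue m 0 = 0.
Proof.
move=> m0; rewrite /capped_revenue (_ : Rintegral _ _ _ = Rintegral P `[0, 1]%classic (cst 0)).
  by rewrite Rintegral_cst// mul0r.
by apply: eq_Rintegral => v; rewrite inE /= in_itv /= => /andP[v0 _]; rewrite min_r.
Qed.

Lemma capped_revenue1 m : capped_revenue m 1 = revenue P m.
Proof.
by apply: eq_Rintegral => v; rewrite inE /= in_itv /= => /andP[_ v1]; rewrite min_l.
Qed.

Let m01 : measurable (`[0, 1]%classic : set (measurableTypeR R)).
Proof. exact: measurable_itv. Qed.

Lemma bounded_integrable01 (f : R -> R) (M : R) : measurable_fun (`[0, 1]%classic : set R) f ->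
  (forall x, 0 <= x <= 1 -> `|f x| <= M) ->
  P.-integrable `[0, 1]%classic (EFin \o f).
Proof.
move=> mf fM; apply: (@bounded_integrable _ _ _ P _ f M) => //.
by apply: le_lt_trans (probability_le1 _ _) (ltry _).
Qed.

Let upper_indic (x v : R) : (x < v)%R%:R = \1_(`]x, +oo[%classic) v :> R.
Proof.
rewrite indicE; congr (nat_of_bool _)%:R.
by apply/idP/idP; rewrite inE /= in_itv /= andbT.
Qed.

Let upper_integrable c x :
  P.-integrable `[0, 1]%classic (EFin \o (fun v : R => c * (x < v)%R%:R)).
Proof.
apply: (@bounded_integrable01 _ `|c|).
  apply: measurable_funM; first exact: measurable_cst.
  rewrite (_ : (fun v => _) = \1_(`]x, +oo[%classic)); last first.
    by apply/funext => v; exact: upper_indic.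
  exact: measurable_indic.
by move=> v _; case: (x < v); rewrite /= ?mulr1 ?mulr0 ?normr0.
Qed.

Lemma Rintegral_upper_indic c x :
  Rintegral P `[0, 1]%classic (fun v : R => c * (x < v)%R%:R) = c * Pbar P x.
Proof.
have mx : measurable (`]x, +oo[%classic : set (measurableTypeR R)).
  exact: measurable_itv.
rewrite RintegralZl//; last first.
  have := upper_integrable 1 x; congr (_.-integrable _ _).
  by apply/funext => v /=; rewrite mul1r.
congr (_ * _); rewrite Pbar_itv /Rintegral.
under eq_integral do rewrite upper_indic.
rewrite integral_indic//; congr fine.
have D0 : P (`]x, +oo[%classic `\` `[0, 1]%classic) = 0%E.
  apply: (@subset_measure0 _ _ _ P _ (~` `[0, 1]%classic)) => //.
  - exact: measurableD.
  - exact: measurableC.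
  apply: etrans (probability_setC P m01) _.
  by move: P01; rewrite /supported01 => ->; rewrite subee.
have /esym := measureDI P mx m01.
by rewrite [X in (X + _)%E]D0 add0e setIC.
Qed.

Let capped_bounds m x : {in `[0, 1] &, {homo m : x y / x <= y}} -> 0 <= x <= 1 ->
  P.-integrable `[0, 1]%classic (EFin \o (fun v : R => m (Num.min v x))).
Proof.
move=> mh /andP[x0 x1].
have cap v : 0 <= v <= 1 -> 0 <= Num.min v x <= 1.
  by case/andP=> v0 v1; rewrite le_min v0 x0 /= ge_min v1.
apply: (@bounded_integrable01 _ (`|m 0| + `|m 1|)).
  apply: homo_measurable_itv => s t s01 t01 st; apply: mh; rewrite ?in_itv /= ?cap//.
  by rewrite le_min2.
move=> v /cap cv; have /andP[c0 c1] := cv.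
have h1 : m 0 <= m (Num.min v x) by apply: mh; rewrite ?in_itv /= ?lexx ?ler01.
have h2 : m (Num.min v x) <= m 1 by apply: mh; rewrite ?in_itv /= ?lexx ?ler01.
have := ler_norm (m 1); have := ler_norm (- m 0); rewrite normrN => h3 h4.
rewrite ler_norml; have := normr_ge0 (m 0); have := normr_ge0 (m 1).
by move=> *; apply/andP; split; lra.
Qed.

(** Moving the cap from [x] to [y] changes only the payment of types above [x],
    and raises it by the full [m y - m x] for types above [y]. *)
Lemma capped_revenue_incr m x y : {in `[0, 1] &, {homo m : x y / x <= y}} ->
  0 <= x -> x <= y -> y <= 1 ->
  Pbar P y * (m y - m x) <= capped_revenue m y - capped_revenue m x
    <= Pbar P x * (m y - m x).
Proof.
move=> mh x0 xy y1.
have y01 : 0 <= y <= 1 by apply/andP; split; lra.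
have x01 : 0 <= x <= 1 by apply/andP; split; lra.
have my := capped_bounds mh y01; have mx := capped_bounds mh x01.
have mxy : m x <= m y by apply: mh.
rewrite /capped_revenue -RintegralB//.
rewrite ![Pbar _ _ * _]mulrC -!Rintegral_upper_indic.
have cap (v z : R) : 0 <= v <= 1 -> 0 <= z <= 1 -> Num.min v z \in `[0, 1].
  by rewrite in_itv /= le_min ge_min => /andP[-> ->] /andP[-> _].
have lower (v : R) : 0 <= v <= 1 ->
    (m y - m x) * (y < v)%R%:R <= m (Num.min v y) - m (Num.min v x).
  move=> v01; have [yv|vy] := ltP y v; rewrite ?mulr1 ?mulr0.
    by rewrite (min_r (le_trans xy (ltW yv))).
  rewrite subr_ge0; apply: mh; rewrite ?cap//.
  by rewrite ge_min lexx.
have upper (v : R) : 0 <= v <= 1 ->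
    m (Num.min v y) - m (Num.min v x) <= (m y - m x) * (x < v)%R%:R.
  move=> v01; have [xv|vx] := ltP x v; rewrite ?mulr1 ?mulr0.
    rewrite lerB//; apply: mh; rewrite ?cap//.
    by rewrite ge_min lexx orbT.
  by rewrite (min_l (le_trans vx xy)) subrr.
apply/andP; split; apply: le_Rintegral => //; try exact: upper_integrable;
  try exact: (integrableB m01 my mx).
Qed.

(** A mechanism is a mixture of posted prices with weights [dq]; prices in
    [[x, y[] earn at most [c] each. *)
Lemma capped_revenue_le q m x y c : mechanism q m -> 0 <= x -> x <= y -> y <= 1 ->
  (forall z, x <= z < y -> z * Pbar P z <= c) ->
  capped_revenue m y - capped_revenue m x <= c * (q y - q x).
Proof.
move=> qm x0 xy y1 Pc; have mh := mechanism_homo qm.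
have /mechanismP[_ qh _ mincr] := qm.
suff : capped_revenue m y - c * q y <= capped_revenue m x - c * q x by lra.
apply: (bisection_le (F := fun z => capped_revenue m z - c * q z) (g := q)) => // s t xs st ty.
move: st; rewrite le_eqVlt => /predU1P[->|st]; first by rewrite !subrr mul0r.
have s0 := le_trans x0 xs; have t1 := le_trans ty y1.
have /andP[_] := capped_revenue_incr mh s0 (ltW st) t1.
have /andP[_] := mincr s t s0 (ltW st) t1.
have := Pc s; rewrite xs (lt_le_trans st ty) => /(_ isT).
have : q s <= q t by apply: qh; rewrite ?in_itv /=; try (apply/andP; split); lra.
have := Pbar_ge0 P s; have := Pbar_le1 P s.
move: (Pbar P s) (capped_revenue m s) (capped_revenue m t) => p a b p1 p0 qst pc h1 h2.
have h3 : p * (m t - m s) <= p * (t * (q t - q s)) by rewrite ler_wpM2l.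
have h4 : s * p * (q t - q s) <= c * (q t - q s) by rewrite ler_wpM2r// subr_ge0.
have h5 : p * ((t - s) * (q t - q s)) <= (t - s) * (q t - q s).
  by rewrite ler_piMl// mulr_ge0// subr_ge0// ltW.
have h6 : p * (t * (q t - q s)) = p * ((t - s) * (q t - q s)) + s * p * (q t - q s) by ring.
lra.
Qed.

Notation leb := (@lebesgue_measure R).

(** Layer-cake formula for a payment with bounded density.  The increments of
    both sides over [[x, y]] lie between [Pbar P y] and [Pbar P x] times
    [m y - m x], which is within the reach of bisection. *)
Lemma revenue_absolutely_continuous (a : R -> R) (k : R) m :
  measurable_fun (`[0, 1]%classic : set R) a -> (forall x, 0 <= x <= 1 -> 0 <= a x <= k) ->
  (forall v, 0 <= v <= 1 -> m v = Rintegral leb `[0, v]%classic a) ->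
  revenue P m = Rintegral leb `[0, 1]%classic (fun x => a x * Pbar P x).
Proof.
move=> ma a01 mE; have k0 : 0 <= k.
  by have /andP[/le_trans] := a01 0 ltac:(by rewrite lexx ler01); apply.
have sub x y : 0 <= x -> y <= 1 -> `[x, y]%classic `<=` (`[0, 1]%classic : set R).
  by move=> x0 y1 z /=; rewrite !in_itv /= => /andP[xz zy]; apply/andP; split; lra.
have ai x y : 0 <= x -> y <= 1 -> leb.-integrable `[x, y]%classic (EFin \o a).
  move=> x0 y1; apply: (@bounded_integrable_itv _ _ _ _ k).
    by apply: measurable_funS ma => //; exact: sub.
  move=> z /andP[xz zy]; have /andP[az zk] := a01 z ltac:(by apply/andP; split; lra).
  by rewrite ger0_norm.
have api x y : 0 <= x -> y <= 1 ->
    leb.-integrable `[x, y]%classic (EFin \o (fun z => a z * Pbar P z)).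
  move=> x0 y1; apply: (@bounded_integrable_itv _ _ _ _ k).
    apply: measurable_funM; last exact: Pbar_measurable.
    by apply: measurable_funS ma => //; exact: sub.
  move=> z /andP[xz zy]; have /andP[az zk] := a01 z ltac:(by apply/andP; split; lra).
  rewrite ger0_norm ?mulr_ge0 ?Pbar_ge0//; apply: le_trans zk.
  by rewrite ler_piMr ?Pbar_le1.
have aci c x y : 0 <= x -> y <= 1 ->
    leb.-integrable `[x, y]%classic (EFin \o (fun z => a z * c)).
  move=> x0 y1; apply: (@bounded_integrable_itv _ _ _ _ (k * `|c|)).
    apply: measurable_funM; last exact: measurable_cst.
    by apply: measurable_funS ma => //; exact: sub.
  move=> z /andP[xz zy]; have /andP[az zk] := a01 z ltac:(by apply/andP; split; lra).
  by rewrite normrM ger0_norm// ler_wpM2r.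
have dm x y : 0 <= x -> x <= y -> y <= 1 ->
    m y - m x = Rintegral leb `[x, y]%classic a.
  move=> x0 xy y1; rewrite !mE; try (by apply/andP; split; lra).
  by apply: Rintegral_itv_split => //; exact: ai.
have dm0 x y : 0 <= x -> x <= y -> y <= 1 -> 0 <= m y - m x <= k * (y - x).
  move=> x0 xy y1; rewrite dm// -[X in X <= _ <= _](mul0r (y - x)).
  apply: Rintegral_itv_bounds => // [|z /andP[xz zy]]; first exact: ai.
  by apply: a01; apply/andP; split; lra.
have mh : {in `[0, 1] &, {homo m : x y / x <= y}}.
  move=> x y; rewrite !in_itv /= => /andP[x0 _] /andP[_ y1] xy.
  by have /andP[] := dm0 x y x0 xy y1; rewrite subr_ge0.
pose F x := capped_revenue m x - Rintegral leb `[0, x]%classic (fun z => a z * Pbar P z).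
suff : F 1 = F 0.
  rewrite /F capped_revenue1 capped_revenue0; last first.
    by rewrite mE ?lexx ?ler01// set_itv1 Rintegral_set1.
  by rewrite set_itv1 Rintegral_set1; lra.
apply: (bisection_eq (g := fun x => - k * Pbar P x)) => // x y x0 xy y1.
have /andP[m0 mk] := dm0 x y x0 xy y1.
have /andP[t1 t2] := capped_revenue_incr mh x0 xy y1.
have := Rintegral_itv_split x0 xy (api 0 y (lexx _) y1).
have i1 : Pbar P y * (m y - m x) <=
    Rintegral leb `[x, y]%classic (fun z => a z * Pbar P z).
  rewrite dm// mulrC -RintegralZr//; last exact: ai.
  apply: le_Rintegral => //; [|exact: api|].
    exact: aci.
  move=> z /=; rewrite in_itv /= => /andP[xz zy].
  have /andP[az zk] := a01 z ltac:(by apply/andP; split; lra).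
  by rewrite ler_wpM2l// Pbar_noninc.
have i2 : Rintegral leb `[x, y]%classic (fun z => a z * Pbar P z) <=
    Pbar P x * (m y - m x).
  rewrite dm// mulrC -RintegralZr//; last exact: ai.
  apply: le_Rintegral => //; [exact: api| |].
    exact: aci.
  move=> z /=; rewrite in_itv /= => /andP[xz zy].
  have /andP[az zk] := a01 z ltac:(by apply/andP; split; lra).
  by rewrite ler_wpM2l// Pbar_noninc.
have pxy : (Pbar P x - Pbar P y) * (m y - m x) <= (Pbar P x - Pbar P y) * (k * (y - x)).
  by rewrite ler_wpM2l// subr_ge0 Pbar_noninc.
rewrite /F; move: i1 i2 t1 t2 pxy.
move: (Rintegral leb `[x, y]%classic _) (Rintegral leb `[0, x]%classic _)
  (Rintegral leb `[0, y]%classic _) => i1 i2 i3 *.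
rewrite ler_norml; apply/andP; split; nra.
Qed.

End revenue.

(** * The distance to a truncated law and its derivative *)

Section shortfall.
Context {R : realType}.
Notation leb := (@lebesgue_measure R).
Context (P0 : probability (measurableTypeR R) R).
Implicit Types (h phi : R -> R) (x s t : R).

Definition shortfall h :=
  Rintegral leb `[0, 1]%classic (fun x => Num.max (Pbar P0 x - h x) 0).

Let I01 : set R := `[0, 1]%classic.

Let mI01 : measurable (I01 : set (measurableTypeR R)).
Proof. exact: measurable_itv. Qed.

Lemma dist_shortfall P h : (forall x, Pbar P x = Num.min (Pbar P0 x) (h x)) ->
  dist P P0 = shortfall h.
Proof.
move=> Ph; apply: eq_Rintegral => x _; rewrite Ph.
by have [ph|hp] := leP (Pbar P0 x) (h x); [rewrite subrr normr0 max_r// subr_le0|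
  rewrite distrC ger0_norm ?subr_ge0 ?(ltW hp)// max_l// subr_ge0 ltW].
Qed.

Lemma law_min h : supported01 P0 -> {homo h : x y / x <= y >-> y <= x} ->
  right_continuous h -> (forall x, 0 <= h x) -> (forall x, x < 0 -> 1 <= h x) ->
  exists2 P, supported01 P & forall x, Pbar P x = Num.min (Pbar P0 x) (h x).
Proof.
move=> P01 h_ni h_rc h0 h1.
apply: survival_function_law => [x y xy|x|x x0|x x1].
- by apply: le_min2; [exact: Pbar_noninc|exact: h_ni].
- apply: (continuous2_cvg _ (@min_continuous _ R (_, _)));
    [exact: Pbar_right_continuous|exact: h_rc].
- by rewrite Pbar_lt0// min_l ?h1.
- by rewrite Pbar_ge1// min_l.
Qed.

Lemma shortfall_integrand_measurable h : measurable_fun I01 h ->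
  measurable_fun I01 (fun x => Num.max (Pbar P0 x - h x) 0).
Proof.
move=> mh; apply: measurable_maxr => //.
by apply: measurable_funB => //; exact: Pbar_measurable.
Qed.

Lemma shortfall_integrable h : measurable_fun I01 h -> (forall x, 0 <= h x) ->
  leb.-integrable I01 (EFin \o (fun x => Num.max (Pbar P0 x - h x) 0)).
Proof.
move=> mh h0; apply: (@bounded_integrable_itv _ _ _ _ 1).
  exact: shortfall_integrand_measurable.
move=> x _; rewrite ger0_norm ?le_max ?lexx ?orbT// ge_max ler01 andbT.
by rewrite lerBlDr (le_trans (Pbar_le1 _ _))// lerDl.
Qed.

Lemma max_sub_lipschitz (p h k : R) :
  `|Num.max (p - h) 0 - Num.max (p - k) 0| <= `|k - h|.
Proof.
have -> : k - h = (p - h) - (p - k) by ring.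
move: (p - h) (p - k) => a b.
by case: (leP a 0) => a0; case: (leP b 0) => b0; rewrite ler_norml;
  case: (ger0P (a - b)) => ab; apply/andP; split; lra.
Qed.

(** Away from the kink [p = h], and at it when the direction [phi] vanishes, the
    positive part is exactly affine for small perturbations. *)
Lemma max_sub_slope (p h phi : R) (e hn : nat -> R) :
  e @ \oo --> 0 -> (\forall n \near \oo, hn n = h + e n * phi) ->
  p != h \/ phi = 0 ->
  \forall n \near \oo,
    Num.max (p - h) 0 - Num.max (p - hn n) 0 = e n * (if h < p then phi else 0).
Proof.
move=> e0 hnE [ph|phi0]; last first.
  by near=> n; rewrite (near hnE n)// phi0 if_same !mulr0 addr0 subrr.
have ephi : (fun n => e n * phi) @ \oo --> 0.
  by rewrite -[X in _ --> X](mul0r phi); apply: cvgM => //; exact: cvg_cst.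
have d0 : 0 < `|p - h| by rewrite normr_gt0 subr_eq0.
have small := cvgr0_norm_lt _ ephi _ d0.
near=> n; rewrite (near hnE n)//.
have : `|e n * phi| < `|p - h| by near: n; exact: small.
rewrite (fun_if ( *%R (e n))) mulr0; move: (e n * phi) => z.
move: ph; rewrite neq_lt => /orP[ph|hp].
  rewrite [`|p - h|]ltr0_norm ?subr_lt0// ltr_norml => /andP[z1 z2].
  rewrite (ltNge h) (ltW ph)/= !max_r ?subrr//; lra.
rewrite [`|p - h|]gtr0_norm ?subr_gt0// ltr_norml => /andP[z1 z2].
rewrite hp !max_l; lra.
Unshelve. all: by end_near. Qed.

(** Differentiation under the integral sign along the perturbations [hn] of
    [h]. *)
Lemma shortfall_slope h (hn : nat -> R -> R) (e : nat -> R) phi C :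
  measurable_fun I01 h -> (forall n, measurable_fun I01 (hn n)) ->
  measurable_fun I01 phi ->
  (forall x, 0 <= h x) -> (forall n x, 0 <= hn n x) ->
  (forall n, e n != 0) -> e @ \oo --> 0 ->
  (forall n x, `|hn n x - h x| <= C * `|e n|) ->
  {ae leb, forall x, I01 x -> \forall n \near \oo, hn n x = h x + e n * phi x} ->
  {ae leb, forall x, I01 x -> Pbar P0 x != h x \/ phi x = 0} ->
  (fun n => (e n)^-1 * (shortfall h - shortfall (hn n))) @ \oo -->
    Rintegral leb I01 (fun x => if h x < Pbar P0 x then phi x else 0).
Proof.
move=> mh mhn mphi h0 hn0 en0 e0 hC near_hn ae_neq.
pose f n x := (e n)^-1 * (Num.max (Pbar P0 x - h x) 0 - Num.max (Pbar P0 x - hn n x) 0).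
pose psi x := if h x < Pbar P0 x then phi x else 0.
have mf n : measurable_fun I01 (f n).
  apply: measurable_funM; first exact: measurable_cst.
  by apply: measurable_funB; exact: shortfall_integrand_measurable.
have mpsi : measurable_fun I01 psi.
  apply: measurable_fun_if => //.
    by apply: measurable_fun_ltr => //; exact: Pbar_measurable.
  by apply: measurable_funS mphi => // x [].
have fC n x : `|f n x| <= C.
  rewrite /f normrM normfV ler_pdivrMl ?normr_gt0//.
  by apply: le_trans (max_sub_lipschitz _ _ _) _; rewrite mulrC.
have [|||||fi _ lim] := @dominated_convergence _ _ _ leb I01 mI01
    (fun n => EFin \o f n) (EFin \o psi) (fun=> C%:E).
  - by move=> n; apply/measurable_EFinP; exact: mf.
  - exact/measurable_EFinP.
  - move: near_hn ae_neq; apply: (@filterS2 _ _ (ae_filter_ringOfSetsType leb)) => x H1 H2 Ix.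
    apply: cvg_near_cst.
    have S := max_sub_slope e0 (H1 Ix) (H2 Ix).
    near=> n; rewrite /f /psi /=; congr (_%:E); rewrite (near S n)//.
    by rewrite mulKf.
  - apply: (@bounded_integrable_itv _ _ _ _ `|C|) => //.
  - by apply: aeW => x n _; rewrite lee_fin.
have -> : (fun n => (e n)^-1 * (shortfall h - shortfall (hn n))) =
    (fun n => Rintegral leb I01 (f n)).
  apply/funext => n; rewrite RintegralZl//; last first.
    exact: (integrableB mI01 (shortfall_integrable mh h0)
      (shortfall_integrable (mhn n) (hn0 n))).
  by rewrite RintegralB//; exact: shortfall_integrable.
apply: fine_cvg; rewrite fineK; first exact: lim.
exact: integrable_fin_num.
Unshelve. all: by end_near. Qed.

End shortfall.

(** * Equal-revenue survival functions *)

Section equal_revenue.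
Context {R : realType}.
Implicit Types (s t x : R).

(** The largest survival function against which no posted price earns more than
    [s]; unlike [s / x] it is bounded, which gives the integrable domination. *)
Definition equal_revenue s x := s / Num.max x s.

Lemma equal_revenue_le s x : 0 < s -> x <= s -> equal_revenue s x = 1.
Proof. by move=> s0 xs; rewrite /equal_revenue max_r// divff ?gt_eqF. Qed.

Lemma equal_revenue_ge s x : s <= x -> equal_revenue s x = s / x.
Proof. by move=> sx; rewrite /equal_revenue max_l. Qed.

Lemma equal_revenue_gt0 s x : 0 < s -> 0 < equal_revenue s x.
Proof. by move=> s0; rewrite divr_gt0// lt_max s0 orbT. Qed.

Lemma equal_revenue_ge0 s x : 0 < s -> 0 <= equal_revenue s x.
Proof. by move=> s0; rewrite ltW// equal_revenue_gt0. Qed.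

Lemma equal_revenue_noninc s : 0 < s ->
  {homo equal_revenue s : x y / x <= y >-> y <= x}.
Proof.
move=> s0 x y xy; rewrite /equal_revenue ler_pM2l// lef_pV2 ?posrE ?lt_max ?s0 ?orbT//.
exact: le_max2.
Qed.

Lemma equal_revenue_measurable s (D : set R) : 0 < s -> measurable D ->
  measurable_fun D (equal_revenue s).
Proof.
by move=> s0 mD; apply: nonincreasing_measurable => //; exact: equal_revenue_noninc.
Qed.

Lemma equal_revenue_continuous s : 0 < s -> continuous (equal_revenue s).
Proof.
move=> s0 x; apply: cvgM; first exact: cvg_cst.
apply: cvgV; first by rewrite gt_eqF// lt_max s0 orbT.
apply: (continuous2_cvg _ (@max_continuous _ R (_, _))); [exact: cvg_id|exact: cvg_cst].
Qed.

Lemma equal_revenue_mul_le s x : 0 < s -> x * equal_revenue s x <= s.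
Proof.
move=> s0; have [xs|sx] := leP x s; first by rewrite equal_revenue_le ?mulr1.
by rewrite equal_revenue_ge ?(ltW sx)// mulrCA divff ?mulr1// gt_eqF// (lt_trans s0).
Qed.

Lemma equal_revenue_mono s t x : 0 < s -> s <= t ->
  equal_revenue s x <= equal_revenue t x <= equal_revenue s x + (t - s) / s.
Proof.
move=> s0 st; have t0 := lt_le_trans s0 st.
have ts0 : 0 <= (t - s) / s by rewrite divr_ge0 ?subr_ge0 ?(ltW s0).
have [xs|sx] := leP x s.
  by rewrite !equal_revenue_le ?(le_trans xs)// lexx lerDl.
have x0 := lt_trans s0 sx; rewrite (equal_revenue_ge (ltW sx)).
have [xt|tx] := leP x t.
  rewrite equal_revenue_le// ler_pdivrMr// mul1r (ltW sx)/=.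
  have : 1 <= s / x + (t - s) / x by rewrite -mulrDl ler_pdivlMr// mul1r; lra.
  move/le_trans; apply; rewrite lerD2l ler_wpM2l ?subr_ge0//.
  by rewrite lef_pV2 ?posrE// ltW.
rewrite equal_revenue_ge ?(ltW tx)// ler_pM2r ?invr_gt0// st/=.
rewrite -lerBlDl -mulrBl ler_wpM2l ?subr_ge0//.
by rewrite lef_pV2 ?posrE// ltW.
Qed.

(** The derivative in the level [s]; it jumps at [x = s], a null set. *)
Lemma equal_revenue_near s x (e : nat -> R) : 0 < s -> x != s -> e @ \oo --> 0 ->
  \forall n \near \oo,
    equal_revenue (s + e n) x = equal_revenue s x + e n * (if s < x then x^-1 else 0).
Proof.
move=> s0 xs e0.
have d0 : 0 < Num.min s `|x - s| by rewrite lt_min s0 normr_gt0 subr_eq0.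
have small := cvgr0_norm_lt _ e0 _ d0.
near=> n.
have : `|e n| < Num.min s `|x - s| by near: n; exact: small.
rewrite lt_min => /andP[]; rewrite ltr_norml => /andP[e1 e2].
move: xs; rewrite neq_lt => /orP[xs|sx].
  rewrite [`|x - s|]ltr0_norm ?subr_lt0// ltr_norml => /andP[z1 z2].
  rewrite ltNge (ltW xs)/= mulr0 addr0 !equal_revenue_le//; lra.
rewrite [`|x - s|]gtr0_norm ?subr_gt0// ltr_norml => /andP[z1 z2].
by rewrite sx !equal_revenue_ge ?mulrDl//; lra.
Unshelve. all: by end_near. Qed.

End equal_revenue.

Section equal_revenue_shortfall.
Context {R : realType}.
Notation leb := (@lebesgue_measure R).
Context (P0 : probability (measurableTypeR R) R).
Context (P01 : supported01 P0).
Implicit Types (s t x : R).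

Let I01 : set R := `[0, 1]%classic.

(** [s / x] and [equal_revenue s x] differ only for [x < s], where both are at
    least [1 >= Pbar P0 x], and at [x = 0]. *)
Lemma dpi_shortfall s : 0 < s -> dpi P0 s = shortfall P0 (equal_revenue s).
Proof.
move=> s0; rewrite /dpi /shortfall.
have sub : `]0, 1]%classic `<=` I01.
  by move=> x; rewrite /I01 /= !in_itv /= => /andP[x0 ->]; rewrite ltW.
have ei : leb.-integrable `]0, 1]%classic
    (EFin \o (fun x => Num.max (Pbar P0 x - equal_revenue s x) 0)).
  apply: integrableS (shortfall_integrable _ _ _) => //.
    exact: equal_revenue_measurable.
  by move=> x; exact: equal_revenue_ge0.
have E x : `]0, 1]%classic x -> Num.max (Pbar P0 x - s / x) 0 =
    Num.max (Pbar P0 x - equal_revenue s x) 0.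
  move=> /=; rewrite in_itv /= => /andP[x0 x1].
  have [sx|xs] := leP s x; first by rewrite equal_revenue_ge.
  have p1 := Pbar_le1 P0 x; rewrite (equal_revenue_le s0 (ltW xs)) !max_r//; first lra.
  have : 1 <= s / x by rewrite ler_pdivlMr// mul1r ltW.
  lra.
rewrite -[LHS]Rintegral_itv_obnd_cbnd; last first.
  apply: eq_integrable ei => //= x; rewrite inE => Ix /=.
  by rewrite E.
rewrite -[RHS]Rintegral_itv_obnd_cbnd//.
by apply: eq_Rintegral => x; rewrite inE => /E.
Qed.

(** The density of the optimal allocation, up to the factor [k]. *)
Definition sale_slope s x : R := if equal_revenue s x < Pbar P0 x then x^-1 else 0.

Lemma sale_region_gt s x : 0 < s -> equal_revenue s x < Pbar P0 x -> s < x < 1.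
Proof.
move=> s0 h; apply/andP; split; rewrite ltNge; apply/negP => h'; move: h; apply/negP.
  by rewrite -leNgt equal_revenue_le// Pbar_le1.
by rewrite -leNgt Pbar_ge1// equal_revenue_ge0.
Qed.

Lemma sale_slope_itv s x : 0 < s -> 0 <= sale_slope s x <= s^-1.
Proof.
move=> s0; rewrite /sale_slope; case: ifPn => [/(sale_region_gt s0)/andP[sx _]|_].
  have x0 := lt_trans s0 sx.
  by rewrite invr_ge0 (ltW x0)/= lef_pV2 ?posrE// ltW.
by rewrite lexx invr_ge0 ltW.
Qed.

Lemma sale_region_if_measurable s (f : R -> R) (D : set R) : 0 < s -> measurable D ->
  measurable_fun D f ->
  measurable_fun D (fun x => if equal_revenue s x < Pbar P0 x then f x else 0).
Proof.
move=> s0 mD mf; apply: measurable_fun_if => //.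
  apply: measurable_fun_ltr; first exact: equal_revenue_measurable.
  exact: Pbar_measurable.
by apply: measurable_funS mf => // x [].
Qed.

(** On [x < s] the level set of [equal_revenue s] need not be null, since both
    survival functions may equal [1] there; the perturbations must leave this
    range unchanged to first order, hence the condition on [phi]. *)
Lemma shortfall_equal_revenue_slope s (hn : nat -> R -> R) (e : nat -> R)
    (phi : R -> R) :
  0 < s -> leb [set x : R | 0 < x < 1 /\ Pbar P0 x = s / x] = 0%E ->
  (forall n, e n != 0) -> (forall n, `|e n| <= s / 2) -> e @ \oo --> 0 ->
  (forall n, measurable_fun I01 (hn n)) -> measurable_fun I01 phi ->
  (forall n x, 0 <= hn n x) ->
  (forall n x, `|hn n x - equal_revenue s x| <=
     `|equal_revenue (s + e n) x - equal_revenue s x|) ->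
  (forall x, x != s ->
     \forall n \near \oo, hn n x = equal_revenue s x + e n * phi x) ->
  (forall x, x < s -> phi x = 0) ->
  (fun n => (e n)^-1 * (shortfall P0 (equal_revenue s) - shortfall P0 (hn n))) @ \oo
    --> Rintegral leb I01 (fun x => if equal_revenue s x < Pbar P0 x then phi x else 0).
Proof.
move=> s0 null en0 es e0 mhn mphi hn0 hnE near_hn phi0.
apply: (shortfall_slope (C := 2 / s)) => //.
- exact: equal_revenue_measurable.
- by move=> x; exact: equal_revenue_ge0.
(* [`|e n| <= s / 2] keeps both levels above [s / 2], whence the constant. *)
- move=> n x; apply: le_trans (hnE n x) _.
  have := es n; rewrite ler_norml => /andP[e1 e2].
  have [en|en] := ger0P (e n).
    have /andP[h1 h2] := @equal_revenue_mono R s (s + e n) x s0 ltac:(lra).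
    rewrite ger0_norm ?subr_ge0// lerBlDl; apply: (le_trans h2); rewrite lerD2l.
    rewrite addrC addKr mulrC ler_wpM2r// ler_peMl ?invr_ge0 ?(ltW s0)//; lra.
  have s1 : 0 < s + e n by lra.
  have /andP[h1 h2] := @equal_revenue_mono R (s + e n) s x s1 ltac:(lra).
  rewrite distrC ger0_norm ?subr_ge0// lerBlDl; apply: (le_trans h2); rewrite lerD2l.
  rewrite opprD addNKr mulrC ler_wpM2r ?oppr_ge0 ?(ltW en)//.
  rewrite -[2 / s]invf_div lef_pV2 ?posrE//; lra.
- rewrite /almost_everywhere; apply: (@negligibleS _ _ _ leb [set s]).
    move=> x /= H; apply: contrapT => /eqP xs; apply: H => _; exact: near_hn.
  by apply/negligibleP => //; exact: lebesgue_measure_set1.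
- rewrite /almost_everywhere.
  pose N := [set x : R | 0 < x < 1 /\ Pbar P0 x = s / x].
  apply: (@negligibleS _ _ _ leb (N `|` [set s])); last first.
    apply: negligibleU; apply/negligibleP => //; last exact: lebesgue_measure_set1.
    have -> : N = `[s, 1[%classic `&`
        ((Pbar P0 \- equal_revenue s) @^-1` [set 0]).
      apply/seteqP; split=> x; rewrite /N /= in_itv /=.
        move=> [/andP[x0 x1] px]; have sx : s <= x.
          by rewrite leNgt; apply/negP => xs; have := Pbar_le1 P0 x;
            rewrite px ler_pdivrMr// mul1r leNgt xs.
        by rewrite sx x1 equal_revenue_ge// px subrr.
      move=> [/andP[sx x1] /eqP]; rewrite subr_eq0 equal_revenue_ge// => /eqP.
      by rewrite (lt_le_trans s0 sx).
    have mf : measurable_fun setT (Pbar P0 \- equal_revenue s).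
      apply: measurable_funB; first exact: Pbar_measurable.
      exact: equal_revenue_measurable.
    by apply: measurableI => //; rewrite -[X in measurable X]setTI; exact: mf.
  move=> x /= H; apply: contrapT => /not_orP[xN xs]; apply: H.
  rewrite /I01 /= in_itv /= => /andP[x0 x1].
  have [xs'|sx] := leP x s.
    right; apply: phi0; rewrite lt_neqAle xs' andbT; exact/eqP.
  left; rewrite (equal_revenue_ge (ltW sx)); apply/eqP => px; apply: xN.
  split => //; rewrite (lt_trans s0 sx)/= lt_neqAle x1 andbT; apply/eqP => xe.
  move: px; rewrite Pbar_ge1 ?xe// => /esym/eqP; rewrite gt_eqF// divr1//.
Qed.

Lemma inv_measurable_ge s (D : set R) : 0 < s -> measurable D ->
  measurable_fun D (fun x => if s < x then x^-1 else 0).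
Proof.
move=> s0 mD.
rewrite (_ : (fun x => _) = (fun x => if s < x then s^-1 * equal_revenue s x else 0)).
  apply: measurable_fun_if => //.
    by apply: measurable_fun_ltr => //; exact: measurable_cst.
  apply: measurable_funM; first exact: measurable_cst.
  by apply: measurable_funS (equal_revenue_measurable s0 mD) => // x [].
apply/funext => x; case: ltP => // sx.
by rewrite equal_revenue_ge ?(ltW sx)// mulrA mulVf ?mul1r// gt_eqF.
Qed.

End equal_revenue_shortfall.

(** * One-sided perturbations of the equal-revenue level *)

Section perturbations.
Context {R : realType}.
Notation leb := (@lebesgue_measure R).
Context (P0 : probability (measurableTypeR R) R).
Context (P01 : supported01 P0).
Context (s : R).
Context (s0 : 0 < s).
Context (null : leb [set x : R | 0 < x < 1 /\ Pbar P0 x = s / x] = 0%E).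
Implicit Types (t x c : R).

Let I01 : set R := `[0, 1]%classic.

Let mI01 : measurable (I01 : set (measurableTypeR R)).
Proof. exact: measurable_itv. Qed.

Notation slope := (sale_slope P0 s).

Lemma sale_slope_integrable a b : leb.-integrable `[a, b]%classic (EFin \o slope).
Proof.
apply: (@bounded_integrable_itv _ _ _ _ s^-1) => [|x _].
  rewrite (_ : slope = (fun x => if equal_revenue s x < Pbar P0 x
      then if s < x then x^-1 else 0 else 0)).
    by apply: sale_region_if_measurable => //; exact: inv_measurable_ge.
  apply/funext => x; rewrite /sale_slope; case: ifPn => // h.
  by have /andP[->] := sale_region_gt P01 s0 h.
by have /andP[h1 h2] := sale_slope_itv P01 x s0; rewrite ger0_norm.
Qed.

Definition sale_log t := Rintegral leb `[0, t]%classic slope.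

Lemma sale_log_split t : 0 <= t <= 1 ->
  Rintegral leb `[t, 1]%classic slope = sale_log 1 - sale_log t.
Proof.
move=> /andP[t0 t1]; rewrite /sale_log Rintegral_itv_split//.
exact: sale_slope_integrable.
Qed.

Let e c n : R := c / n.+1%:R.

Let e_neq0 c n : c != 0 -> e c n != 0.
Proof. by move=> c0; rewrite mulf_neq0// invr_neq0// pnatr_eq0. Qed.

Let e_gt0 c n : 0 < c -> 0 < e c n.
Proof. by move=> c0; rewrite divr_gt0// ltr0n. Qed.

Let e_norm_le c n : `|e c n| <= `|c|.
Proof.
rewrite normrM normfV ler_pdivrMr ?normr_gt0 ?pnatr_eq0// ler_peMr//.
by rewrite ger0_norm// ler1n.
Qed.

Let e_cvg c : e c @ \oo --> 0.
Proof.
rewrite -[X in _ --> X](mulr0 c); apply: cvgM; first exact: cvg_cst.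
exact: cvg_harmonic.
Qed.

Let er_measurable r : 0 < r -> measurable_fun I01 (equal_revenue r).
Proof. by move=> r0; exact: equal_revenue_measurable. Qed.

Let e_small c n : `|c| <= s / 2 -> 0 < s + e c n.
Proof.
move=> cs; have := e_norm_le c n; move=> /le_trans /(_ cs).
by rewrite ler_norml => /andP[e1 e2]; have s0' := s0; lra.
Qed.

Let phi0 x : R := if s < x then x^-1 else 0.

Let phi_slope x :
  (if equal_revenue s x < Pbar P0 x then phi0 x else 0) = slope x.
Proof.
rewrite /sale_slope; case: ifPn => // h.
by rewrite /phi0; have /andP[->] := sale_region_gt P01 s0 h.
Qed.

Let phi0_lt x : x < s -> phi0 x = 0.
Proof. by move=> xs; rewrite /phi0 ltNge (ltW xs). Qed.

Lemma slope_global c : c != 0 -> `|c| <= s / 2 ->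
  (fun n => (e c n)^-1 * (shortfall P0 (equal_revenue s) -
     shortfall P0 (equal_revenue (s + e c n)))) @ \oo --> sale_log 1.
Proof.
move=> c0 cs; rewrite /sale_log.
rewrite (@eq_Rintegral _ _ _ leb I01
  (fun x => if equal_revenue s x < Pbar P0 x then phi0 x else 0)); last first.
  by move=> x _; rewrite phi_slope.
apply: (shortfall_equal_revenue_slope P01 s0 null) => //;
  try exact: measurable_funS mphi.
- by move=> n; exact: e_neq0.
- by move=> n; apply: le_trans cs.
- by move=> n; apply: er_measurable; exact: e_small.
- exact: inv_measurable_ge.
- by move=> n x; apply: equal_revenue_ge0; exact: e_small.
- by move=> x xs; exact: equal_revenue_near.
Qed.

Definition raised_below t r x := if x < t then equal_revenue r x else equal_revenue s x.

(** Below [t] the level is [s].  Above [t] the survival function stays flat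
    until it meets the level [r]: it cannot jump upwards at [t]. *)
Definition raised_above t r x :=
  Num.min (equal_revenue r x) (equal_revenue s (Num.min x t)).

Lemma slope_below t c : 0 <= t <= 1 -> c != 0 -> `|c| <= s / 2 ->
  (fun n => (e c n)^-1 * (shortfall P0 (equal_revenue s) -
     shortfall P0 (raised_below t (s + e c n)))) @ \oo --> sale_log t.
Proof.
move=> /andP[t0 t1] c0 cs.
pose phi x := if x < t then phi0 x else 0.
pose f x := if equal_revenue s x < Pbar P0 x then phi x else 0.
have fE x : x < t -> f x = slope x.
  by move=> xt; rewrite -phi_slope /f /phi xt.
have f0 x : t <= x -> f x = 0.
  by move=> tx; rewrite /f /phi (ltNge x t) tx/= if_same.
have mphi : measurable_fun setT phi.
  apply: measurable_fun_if => //; first by apply: measurable_fun_ltr => //; exact: measurable_cst.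
  by apply: measurable_funS (inv_measurable_ge s0 measurableT) => // x [].
have fi a b : leb.-integrable `[a, b]%classic (EFin \o f).
  apply: (@bounded_integrable_itv _ _ _ _ s^-1) => [|x _].
    apply: sale_region_if_measurable => //; exact: measurable_funS mphi.
  have /andP[h1 h2] := sale_slope_itv P01 x s0.
  have [xt|tx] := ltP x t; last by rewrite f0// normr0 invr_ge0 ltW.
  by rewrite fE// ger0_norm.
have -> : sale_log t = Rintegral leb I01 f.
  have := Rintegral_itv_split t0 t1 (fi 0 1).
  rewrite (_ : Rintegral leb `[t, 1]%classic f = 0); last first.
    rewrite (@eq_Rintegral _ _ _ leb _ (cst 0)).
      by rewrite Rintegral_itv_cst// mul0r.
    by move=> x; rewrite inE /= in_itv /= => /andP[tx _]; exact: f0.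
  move/eqP; rewrite subr_eq0 => /eqP ->; rewrite /sale_log.
  rewrite -[LHS]Rintegral_itv_bndo_bndc; last first.
    by apply: integrableS (sale_slope_integrable 0 t) => //; apply: subset_itvl; rewrite bnd_simp.
  rewrite -[RHS]Rintegral_itv_bndo_bndc; last first.
    by apply: integrableS (fi 0 t) => //; apply: subset_itvl; rewrite bnd_simp.
  by apply: eq_Rintegral => x; rewrite inE /= in_itv /= => /andP[_ /fE].
apply: (shortfall_equal_revenue_slope (phi := phi) P01 s0 null) => //;
  try exact: measurable_funS mphi.
- by move=> n; exact: e_neq0.
- by move=> n; apply: le_trans cs.
- move=> n; apply: measurable_fun_if => //.
  + by apply: measurable_fun_ltr => //; exact: measurable_cst.
  + by apply: measurable_funS (er_measurable (e_small n cs)) => // x [].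
  + by apply: measurable_funS (er_measurable s0) => // x [].
- move=> n x; rewrite /raised_below; case: ifP => _; apply: equal_revenue_ge0 => //.
  exact: e_small.
- by move=> n x; rewrite /raised_below; case: ifP => _//; rewrite subrr normr0.
- move=> x xs; rewrite /raised_below /phi; case: ifP => _; first exact: equal_revenue_near.
  by near=> n; rewrite mulr0 addr0.
- by move=> x xs; rewrite /phi phi0_lt// if_same.
Unshelve. all: by end_near. Qed.

Lemma slope_above t c : 0 <= t <= 1 -> 0 < c -> c <= s / 2 ->
  (fun n => (e c n)^-1 * (shortfall P0 (equal_revenue s) -
     shortfall P0 (raised_above t (s + e c n)))) @ \oo --> sale_log 1 - sale_log t.
Proof.
move=> t01 c0 cs; have /andP[t0 t1] := t01.
have cs' : `|c| <= s / 2 by rewrite gtr0_norm.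
pose phi x := if t < x then phi0 x else 0.
pose f x := if equal_revenue s x < Pbar P0 x then phi x else 0.
have fE x : t < x -> f x = slope x.
  by move=> xt; rewrite -phi_slope /f /phi xt.
have f0 x : x <= t -> f x = 0.
  by move=> tx; rewrite /f /phi (ltNge t x) tx/= if_same.
have mphi : measurable_fun setT phi.
  apply: measurable_fun_if => //; first by apply: measurable_fun_ltr => //; exact: measurable_cst.
  by apply: measurable_funS (inv_measurable_ge s0 measurableT) => // x [].
have fi a b : leb.-integrable `[a, b]%classic (EFin \o f).
  apply: (@bounded_integrable_itv _ _ _ _ s^-1) => [|x _].
    apply: sale_region_if_measurable => //; exact: measurable_funS mphi.
  have /andP[h1 h2] := sale_slope_itv P01 x s0.
  have [xt|tx] := ltP t x; last by rewrite f0// normr0 invr_ge0 ltW.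
  by rewrite fE// ger0_norm.
rewrite -sale_log_split//.
have -> : Rintegral leb `[t, 1]%classic slope = Rintegral leb I01 f.
  have := Rintegral_itv_split t0 t1 (fi 0 1).
  rewrite (_ : Rintegral leb `[0, t]%classic f = 0); last first.
    rewrite (@eq_Rintegral _ _ _ leb _ (cst 0)).
      by rewrite Rintegral_itv_cst// mul0r.
    by move=> x; rewrite inE /= in_itv /= => /andP[_ tx]; exact: f0.
  rewrite subr0 => ->.
  rewrite -[LHS]Rintegral_itv_obnd_cbnd; last first.
    by apply: integrableS (sale_slope_integrable t 1) => //; apply: subset_itvr; rewrite bnd_simp.
  rewrite -[RHS]Rintegral_itv_obnd_cbnd; last first.
    by apply: integrableS (fi t 1) => //; apply: subset_itvr; rewrite bnd_simp.
  by apply: eq_Rintegral => x; rewrite inE /= in_itv /= => /andP[/fE].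
have er_le n x : equal_revenue s x <= equal_revenue (s + e c n) x.
  by have /andP[] := @equal_revenue_mono R s (s + e c n) x s0 ltac:(by rewrite lerDl ltW ?e_gt0).
have er_lo n x : equal_revenue s x <= raised_above t (s + e c n) x.
  by rewrite /raised_above le_min er_le/= equal_revenue_noninc// ge_min lexx.
apply: (shortfall_equal_revenue_slope (phi := phi) P01 s0 null) => //;
  try exact: measurable_funS mphi.
- by move=> n; rewrite e_neq0// gt_eqF.
- by move=> n; apply: le_trans cs'.
- move=> n; apply: measurable_minr; first by apply: er_measurable; exact: e_small.
  apply: nonincreasing_measurable => // x y xy; apply: equal_revenue_noninc => //.
  exact: le_min2.
- by move=> n x; apply: le_trans (er_lo n x); exact: equal_revenue_ge0.
- move=> n x; rewrite !ger0_norm ?subr_ge0 ?er_lo ?er_le// lerB//.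
  by rewrite /raised_above ge_min lexx.
- move=> x xs; rewrite /raised_above /phi; have [tx|xt] := ltP t x; last first.
    by near=> n; rewrite min_r// mulr0 addr0.
  have nr := equal_revenue_near s0 xs (e_cvg c).
  have lt_er : x < s \/ equal_revenue s x < equal_revenue s t.
    move: xs; rewrite neq_lt => /orP[|sx]; [by left|right].
    rewrite (equal_revenue_ge (ltW sx)).
    have [st|ts] := leP s t; last first.
      by rewrite (equal_revenue_le s0 (ltW ts)) ltr_pdivrMr ?mul1r// (lt_trans s0).
    have x0 := lt_trans s0 sx; have tpos := lt_le_trans s0 st.
    by rewrite equal_revenue_ge// ltr_pM2l// ltf_pV2.
  case: lt_er => [xs'|lt_er].
    near=> n; rewrite phi0_lt// mulr0 addr0.
    rewrite !equal_revenue_le ?minxx ?(ltW xs') ?(ltW (lt_trans tx xs'))//.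
      by rewrite addr_gt0// e_gt0.
    by rewrite (le_trans (ltW xs'))// lerDl ltW// e_gt0.
  have d0 : 0 < equal_revenue s t - equal_revenue s x by rewrite subr_gt0.
  have ephi : (fun n => e c n * phi0 x) @ \oo --> 0.
    rewrite -[X in _ --> X](mul0r (phi0 x)); apply: cvgM => //; exact: cvg_cst.
  have small := cvgr0_norm_lt _ ephi _ d0.
  near=> n; rewrite min_l ?(near nr n)// -/(phi0 x).
  have : `|e c n * phi0 x| < equal_revenue s t - equal_revenue s x by near: n; exact: small.
  by rewrite ltr_norml => /andP[_]; lra.
- by move=> x xs; rewrite /phi phi0_lt// if_same.
Unshelve. all: by end_near. Qed.

End perturbations.

(** * Testing feasibility against truncated laws *)

Section test_laws.
Context {R : realType}.
Notation leb := (@lebesgue_measure R).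
Context (P0 : probability (measurableTypeR R) R).
Context (P01 : supported01 P0).
Implicit Types (s t r x c k tau : R) (q m h : R -> R).

(** Two price ranges with separate revenue caps are kept, because the
    perturbations that pin down [q t] change the cap at [t] only. *)
Lemma feasible_test q m k tau h t c1 c2 :
  RS_feasible P0 tau q m k ->
  {homo h : x y / x <= y >-> y <= x} -> right_continuous h ->
  (forall x, 0 <= h x) -> (forall x, x < 0 -> 1 <= h x) ->
  0 <= t <= 1 ->
  (forall x, 0 <= x < t -> x * h x <= c1) ->
  (forall x, t <= x < 1 -> x * h x <= c2) ->
  tau <= c1 * (q t - q 0) + c2 * (q 1 - q t) + k * shortfall P0 h.
Proof.
move=> [qm k0 feas] h_ni h_rc h0 h1 /andP[t0 t1] hc1 hc2.
have [P PS PE] := law_min P01 h_ni h_rc h0 h1.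
have := feas P PS; rewrite (dist_shortfall PE) lerBlDr => /le_trans; apply.
rewrite addrC lerD2r -capped_revenue1.
have /mechanismP[_ _ m0 _] := qm.
have Pc x : 0 <= x -> x * Pbar P x <= x * h x.
  by move=> x0; rewrite ler_wpM2l// PE ge_min lexx orbT.
have b1 : capped_revenue P m t - capped_revenue P m 0 <= c1 * (q t - q 0).
  apply: capped_revenue_le => // z /andP[z0 zt]; apply: le_trans (Pc z z0) _.
  by rewrite hc1// z0.
have b2 : capped_revenue P m 1 - capped_revenue P m t <= c2 * (q 1 - q t).
  apply: capped_revenue_le => // z /andP[tz z1].
  by apply: le_trans (Pc z (le_trans t0 tz)) _; rewrite hc2// tz.
have := lerD b1 b2; rewrite capped_revenue0//; lra.
Qed.

Lemma raised_below_noninc s t r : 0 < s -> s <= r ->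
  {homo raised_below s t r : x y / x <= y >-> y <= x}.
Proof.
move=> s0 sr x y xy; have r0 := lt_le_trans s0 sr; rewrite /raised_below.
case: ifPn => yt; first by rewrite (le_lt_trans xy yt) equal_revenue_noninc.
case: ifPn => xt; last exact: equal_revenue_noninc.
apply: le_trans (equal_revenue_noninc s0 xy) _.
by have /andP[] := equal_revenue_mono x s0 sr.
Qed.

Lemma raised_below_right_continuous s t r : 0 < s -> 0 < r ->
  right_continuous (raised_below s t r).
Proof.
move=> s0 r0 x; rewrite /raised_below; have [xt|tx] := ltP x t.
  apply: cvg_trans; last exact: cvg_at_right_filter (equal_revenue_continuous r0 (x := x)).
  apply: near_eq_cvg; near=> y.
  have -> // : y < t by near: y; exact: nbhs_right_lt.
apply: cvg_trans; last exact: cvg_at_right_filter (equal_revenue_continuous s0 (x := x)).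
apply: near_eq_cvg; near=> y.
by rewrite ltNge (le_trans tx).
Unshelve. all: by end_near. Qed.

Lemma raised_above_noninc s t r : 0 < s -> 0 < r ->
  {homo raised_above s t r : x y / x <= y >-> y <= x}.
Proof.
move=> s0 r0 x y xy; apply: le_min2; first exact: equal_revenue_noninc.
by apply: equal_revenue_noninc => //; exact: le_min2.
Qed.

Lemma raised_above_continuous s t r : 0 < s -> 0 < r ->
  continuous (raised_above s t r).
Proof.
move=> s0 r0 x; apply: (continuous2_cvg _ (@min_continuous _ R (_, _))).
  exact: equal_revenue_continuous.
apply: (cvg_comp _ (equal_revenue s)); last exact: equal_revenue_continuous.
by apply: (continuous2_cvg _ (@min_continuous _ R (_, _))); [exact: cvg_id|exact: cvg_cst].
Qed.

(** Truncation at the equal-revenue level [s] limits every revenue to [s]. *)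
Lemma feasible_le s q m k tau : 0 < s -> RS_feasible P0 tau q m k ->
  tau <= s + k * dpi P0 s.
Proof.
move=> s0 feas; rewrite dpi_shortfall//.
have c1 x : x * equal_revenue s x <= s by exact: equal_revenue_mul_le.
have := @feasible_test q m k tau (equal_revenue s) 0 s s feas
  (equal_revenue_noninc s0) (fun x => cvg_at_right_filter (equal_revenue_continuous s0 (x := x)))
  (fun x => equal_revenue_ge0 x s0).
move=> /(_ _ _ (fun x _ => c1 x) (fun x _ => c1 x)) H.
have [[q01 _ _] k0 _] := feas.
have /andP[q00 _] := q01 0 ltac:(by rewrite in_itv /= lexx ler01).
have /andP[_ q11] := q01 1 ltac:(by rewrite in_itv /= lexx ler01).
have := H _ ltac:(by rewrite lexx ler01).
rewrite subrr mulr0 add0r => /(_ _)/le_trans; apply => [x x0|].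
  by rewrite equal_revenue_le// (le_trans (ltW x0))// ltW.
by rewrite lerD2r ler_piMr ?(ltW s0)//; lra.
Qed.

Section first_order.
Context (s : R) (s0 : 0 < s).
Context (null : leb [set x : R | 0 < x < 1 /\ Pbar P0 x = s / x] = 0%E).

Let e n : R := s / 2 / n.+1%:R.

Let e_gt0 n : 0 < e n.
Proof. by rewrite !divr_gt0. Qed.

(** Raising the level by [e] below [t] brings at most [e * q t] of additional
    revenue and shortens the distance to [P0] by [e * sale_log P0 s t] to first
    order; the constraint, tight at level [s], compares the two. *)
Lemma optimal_ge q m k t : RS_feasible P0 (s + k * dpi P0 s) q m k ->
  0 <= t <= 1 -> k * sale_log P0 s t <= q t.
Proof.
move=> feas t01; have [qm k0 _] := feas.
have [q01 _ _] := qm.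
have /andP[q00 _] := q01 0 ltac:(by rewrite in_itv /= lexx ler01).
have /andP[_ q11] := q01 1 ltac:(by rewrite in_itv /= lexx ler01).
have c0 : s / 2 != 0 by rewrite mulf_neq0 ?invr_neq0 ?gt_eqF.
have cs : `|s / 2| <= s / 2 by rewrite ger0_norm// divr_ge0// ltW.
have lim := slope_below P01 s0 null t01 c0 cs.
have klim : (fun n => k * ((e n)^-1 * (shortfall P0 (equal_revenue s) -
    shortfall P0 (raised_below s t (s + e n))))) @ \oo --> k * sale_log P0 s t.
  by apply: cvgM; [exact: cvg_cst|exact: lim].
apply: (cvgr_to_le klim); apply: nearW => n /=; rewrite -/(e n).
have en := e_gt0 n; have sen : s <= s + e n by rewrite lerDl ltW.
have se0 := lt_le_trans s0 sen.
have := @feasible_test q m k _ (raised_below s t (s + e n)) t (s + e n) s feas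
  (raised_below_noninc t s0 sen) (@raised_below_right_continuous s t _ s0 se0) _ _ t01.
rewrite -/(e n) dpi_shortfall// => H.
rewrite mulrCA ler_pdivrMl//.
have : s + k * shortfall P0 (equal_revenue s) <=
  (s + e n) * (q t - q 0) + s * (q 1 - q t) + k * shortfall P0 (raised_below s t (s + e n)).
  apply: H => [x|x x0|x /andP[x0 xt]|x /andP[tx x1]]; rewrite /raised_below.
  - by case: ifP => _; exact: equal_revenue_ge0.
  - by case: ifP => _; rewrite equal_revenue_le// ltW// (lt_trans x0).
  - by rewrite xt equal_revenue_mul_le.
  - by rewrite ltNge tx/= equal_revenue_mul_le.
have h1 : 0 <= s * (1 - q 1) by rewrite mulr_ge0 ?(ltW s0) ?subr_ge0.
have h2 : 0 <= s * q 0 by rewrite mulr_ge0 ?(ltW s0).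
have h3 : 0 <= e n * q 0 by rewrite mulr_ge0 ?(ltW en).
lra.
Qed.

(** The same comparison with the level raised above [t]. *)
Lemma optimal_le q m k t : RS_feasible P0 (s + k * dpi P0 s) q m k ->
  0 <= t <= 1 -> k * (sale_log P0 s 1 - sale_log P0 s t) <= 1 - q t.
Proof.
move=> feas t01; have [qm k0 _] := feas.
have [q01 _ _] := qm.
have /andP[q00 _] := q01 0 ltac:(by rewrite in_itv /= lexx ler01).
have /andP[_ q11] := q01 1 ltac:(by rewrite in_itv /= lexx ler01).
have c0 : 0 < s / 2 by rewrite divr_gt0.
have lim := slope_above P01 s0 null t01 c0 (lexx _).
have klim : (fun n => k * ((e n)^-1 * (shortfall P0 (equal_revenue s) -
    shortfall P0 (raised_above s t (s + e n))))) @ \oo --> k * (sale_log P0 s 1 - sale_log P0 s t).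
  by apply: cvgM; [exact: cvg_cst|exact: lim].
apply: (cvgr_to_le klim); apply: nearW => n /=; rewrite -/(e n).
have en := e_gt0 n; have sen : s <= s + e n by rewrite lerDl ltW.
have se0 := lt_le_trans s0 sen.
have := @feasible_test q m k _ (raised_above s t (s + e n)) t s (s + e n) feas
  (raised_above_noninc t s0 se0)
  (fun x => cvg_at_right_filter (@raised_above_continuous s t _ s0 se0 x)) _ _ t01.
rewrite -/(e n) dpi_shortfall// => H.
rewrite mulrCA ler_pdivrMl//.
have : s + k * shortfall P0 (equal_revenue s) <=
  s * (q t - q 0) + (s + e n) * (q 1 - q t) + k * shortfall P0 (raised_above s t (s + e n)).
  apply: H => [x|x x0|x /andP[x0 xt]|x /andP[tx x1]]; rewrite /raised_above.
  - by rewrite le_min !equal_revenue_ge0.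
  - by rewrite le_min !equal_revenue_le ?lexx// ?ge_min ltW// (lt_trans x0).
  - apply: le_trans (equal_revenue_mul_le x s0); rewrite ler_wpM2l//.
    by rewrite ge_min (min_l (ltW xt)) lexx orbT.
  - apply: le_trans (equal_revenue_mul_le x se0); rewrite ler_wpM2l//.
      by case/andP: t01 => t0 _; exact: le_trans t0 tx.
    by rewrite ge_min lexx.
have h1 : 0 <= s * (1 - q 1) by rewrite mulr_ge0 ?(ltW s0) ?subr_ge0.
have h2 : 0 <= s * q 0 by rewrite mulr_ge0 ?(ltW s0).
have h3 : 0 <= e n * (1 - q 1) by rewrite mulr_ge0 ?(ltW en) ?subr_ge0.
lra.
Qed.

End first_order.
End test_laws.

(** * The minimizer of the dual objective *)

Lemma inv_integrable (R : realType) (a b : R) : 0 < a ->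
  (@lebesgue_measure R).-integrable `[a, b]%classic (EFin \o (fun x => x^-1)).
Proof.
move=> a0; apply: (@bounded_integrable_itv _ _ _ _ a^-1).
  apply: (eq_measurable_fun (fun z => if a / 2 < z then z^-1 else 0)); last first.
    by apply: inv_measurable_ge; rewrite ?divr_gt0.
  move=> z; rewrite inE /= in_itv /= => /andP[az _].
  by have -> : a / 2 < z by lra.
move=> z /andP[az _]; have z0 := lt_le_trans a0 az.
by rewrite ger0_norm ?invr_ge0 ?(ltW z0)// lef_pV2.
Qed.

(** [x |-> ln x] and the integral have increments between [(y - x) / y] and
    [(y - x) / x], so bisection applies with [g x = - 1 / x]. *)
Lemma Rintegral_inv (R : realType) (a b : R) : 0 < a -> a <= b ->
  Rintegral (@lebesgue_measure R) `[a, b]%classic (fun x => x^-1) = ln (b / a).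
Proof.
move=> a0 ab; have b0 := lt_le_trans a0 ab.
have fi x y : a <= x -> (@lebesgue_measure R).-integrable `[x, y]%classic
    (EFin \o (fun x => x^-1)).
  by move=> ax; apply: inv_integrable; exact: lt_le_trans a0 ax.
pose F x := Rintegral (@lebesgue_measure R) `[a, x]%classic (fun x => x^-1) - ln x.
suff : F b = F a.
  by rewrite /F set_itv1 Rintegral_set1 ln_div ?posrE//; lra.
apply: (bisection_eq (g := fun x => - x^-1)) => // x y ax xy yb.
have x0 := lt_le_trans a0 ax; have y0 := lt_le_trans x0 xy.
have := Rintegral_itv_split ax xy (fi a y (lexx _)).
have /andP[] : y^-1 * (y - x) <= Rintegral lebesgue_measure `[x, y]%classic (fun x => x^-1)
    <= x^-1 * (y - x).
  apply: Rintegral_itv_bounds => //; first exact: fi.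
  by move=> z /andP[xz zy]; have z0 := lt_le_trans x0 xz; rewrite !lef_pV2 ?posrE// zy xz.
have ln_le (z z' : R) : 0 < z -> 0 < z' -> ln z - ln z' <= z'^-1 * (z - z').
  move=> z0 z0'; rewrite -ln_div ?posrE// mulrBr mulVf ?gt_eqF// [_ * z]mulrC.
  have := @le_ln1Dx R (z / z' - 1); rewrite [1 + _]addrC subrK; apply.
  by rewrite ltrBrDr addNr divr_gt0.
have l1 := ln_le y x y0 x0; have l2 := ln_le x y x0 y0.
rewrite /F; move: l1 l2.
move: (Rintegral (@lebesgue_measure R) `[x, y]%classic _)
  (Rintegral (@lebesgue_measure R) `[a, x]%classic _)
  (Rintegral (@lebesgue_measure R) `[a, y]%classic _) (ln x) (ln y) x^-1 y^-1
  => i1 i2 i3 lx ly x' y' h1 h2 h3 h4 h5.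
by rewrite ler_norml; apply/andP; split; nra.
Qed.

Section minimizer.
Context {R : realType}.
Notation leb := (@lebesgue_measure R).
Context (P0 : probability (measurableTypeR R) R).
Context (P01 : supported01 P0).
Implicit Types (s t x k : R).

Let mge x : measurable (`[x, +oo[%classic : set (measurableTypeR R)).
Proof. exact: measurable_itv. Qed.

Lemma Pi0_ge x : 0 <= x <= 1 -> x * fine (P0 `[x, +oo[%classic) <= Pi0 P0.
Proof.
move=> x01; apply: ub_le_sup; last by exists x => //=; rewrite in_itv.
exists 1 => _ [y /= + <-]; rewrite in_itv /= => /andP[y0 y1].
have /andP[p0 p1] := fine_probability_01 P0 (mge y).
by rewrite (le_trans (ler_piMr y0 p1)).
Qed.

Lemma mul_Pbar_le_Pi0 x : 0 <= x <= 1 -> x * Pbar P0 x <= Pi0 P0.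
Proof.
move=> x01; apply: le_trans (Pi0_ge x01); have /andP[x0 _] := x01.
rewrite ler_wpM2l// Pbar_itv; apply: fine_probability_le => //.
by apply: subset_itvr; rewrite bnd_simp.
Qed.

Lemma Pi0_gt0_price : 0 < Pi0 P0 ->
  exists y, [/\ 0 < y, y <= 1 & 0 < fine (P0 `[y, +oo[%classic)].
Proof.
move=> Pi_gt0; apply: contrapT => H; move: Pi_gt0; apply/negP; rewrite -leNgt.
apply: ge_sup.
  by exists (0 * fine (P0 `[0, +oo[%classic)); exists 0 => //=; rewrite in_itv /= lexx ler01.
move=> _ [y /= + <-]; rewrite in_itv /= => /andP[y0 y1].
rewrite leNgt; apply/negP => yp; apply: H; exists y.
have /andP[p0 p1] := fine_probability_01 P0 (mge y).
have yp' : 0 < y by rewrite lt_neqAle y0 andbT; apply: contraTneq yp => <-; rewrite mul0r ltxx.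
by split => //; rewrite pmulr_rgt0 in yp.
Qed.

Lemma shortfall_drop_ge a b s : 0 < s -> s <= a -> a <= b -> b <= 1 ->
  (forall x, a <= x <= b -> equal_revenue s x <= Pbar P0 x) ->
  s * ln (b / a) <= dpi P0 0 - dpi P0 s.
Proof.
move=> s0 sa ab b1 H; have a0 := lt_le_trans s0 sa.
have -> : dpi P0 0 = shortfall P0 (cst 0).
  by apply: eq_Rintegral => x _; rewrite mul0r.
rewrite dpi_shortfall// /shortfall.
have i1 : leb.-integrable `[0, 1]%classic (EFin \o (fun x => Num.max (Pbar P0 x - cst 0 x) 0)).
  by apply: shortfall_integrable => //; exact: measurable_cst.
have i2 : leb.-integrable `[0, 1]%classic
    (EFin \o (fun x => Num.max (Pbar P0 x - equal_revenue s x) 0)).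
  apply: shortfall_integrable; first exact: equal_revenue_measurable.
  by move=> x; exact: equal_revenue_ge0.
rewrite -RintegralB//.
pose f x := Num.max (Pbar P0 x - cst 0 x) 0 - Num.max (Pbar P0 x - equal_revenue s x) 0.
have f0 x : 0 <= f x.
  rewrite /f subr_ge0 /= subr0; apply: le_max2 => //.
  by rewrite gerBl equal_revenue_ge0.
have fi x y : 0 <= x -> y <= 1 -> leb.-integrable `[x, y]%classic (EFin \o f).
  move=> x0 y1; apply: (@integrableS _ _ _ leb `[0, 1]%classic) => //.
    by move=> z /=; rewrite !in_itv /= => /andP[xz zy]; apply/andP; split; lra.
  exact: integrableB i1 i2.
rewrite -/f.
have h1 := Rintegral_itv_split (ltW a0) (le_trans ab b1) (fi 0 1 (lexx _) (lexx _)).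
have h2 := Rintegral_itv_split ab b1 (fi a 1 (ltW a0) (lexx _)).
have g0 x y : 0 <= Rintegral leb `[x, y]%classic f by apply: Rintegral_ge0 => z _; exact: f0.
have fE (x : R) : a <= x <= b -> s * x^-1 = f x.
  move=> xab; have h := H x xab; have /andP[ax _] := xab.
  rewrite /f /= subr0 !max_l ?Pbar_ge0 ?subr_ge0//.
  by rewrite opprB addrC subrK equal_revenue_ge// (le_trans sa).
have : s * ln (b / a) = Rintegral leb `[a, b]%classic f.
  rewrite -Rintegral_inv// -RintegralZl//; last first.
    exact: inv_integrable.
  apply: eq_Rintegral => x; rewrite inE /= in_itv /= => xab.
  exact: fE.
move=> ->; rewrite -(subrK (Rintegral leb `[0, a]%classic f) (Rintegral leb `[0, 1]%classic f)).
by rewrite h1 -(subrK (Rintegral leb `[a, b]%classic f) (Rintegral leb `[a, 1]%classic f)) h2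
  addrAC lerDr addr_ge0.
Qed.

(** The slope of [d] at [0] is infinite: [d 0 - d e >= e * ln (b / a)] on a price
    range [[a, b]] with [b] fixed and [a] proportional to [e], so a level [e]
    with [ln (b / a) > 1 / k] does better than [0]. *)
Lemma argmin_gt0 k s : 0 < Pi0 P0 -> 0 < k -> is_argmin_rho P0 k s -> 0 < s.
Proof.
move=> Pi_gt0 k0 []; rewrite in_itv /= => /andP[+ _]; rewrite le_eqVlt => /predU1P[<-|//].
move=> H; exfalso.
have [y [y0 y1 p0]] := Pi0_gt0_price Pi_gt0.
set p := fine _ in p0.
have /andP[_ p1] := fine_probability_01 P0 (mge y); rewrite -/p in p1.
(* The choice makes [ln (b / a) = 2 / k]; [e <= p * x] on [[a, b]] keeps the
   equal-revenue curve below [p <= Pbar P0 x]. *)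
pose b := y / 2; pose a := b * expR (- (2 / k)); pose e := p * a.
have b0 : 0 < b by rewrite divr_gt0.
have a0 : 0 < a by rewrite mulr_gt0// expR_gt0.
have e0 : 0 < e by rewrite mulr_gt0.
have ab : a <= b by rewrite ler_piMr ?(ltW b0)// -expR0 ler_expR oppr_le0 divr_ge0// ltW.
have by' : b < y by rewrite /b; lra.
have ea : e <= a by rewrite ler_piMl ?(ltW a0).
have drop : e * ln (b / a) <= dpi P0 0 - dpi P0 e.
  apply: shortfall_drop_ge => // [|x /andP[ax xb]]; first lra.
  have x0 := lt_le_trans a0 ax.
  rewrite equal_revenue_ge ?(le_trans ea)//; apply: (@le_trans _ _ p).
    by rewrite ler_pdivrMr// ler_wpM2l// ltW.
  rewrite Pbar_itv; apply: fine_probability_le => //.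
  by apply: subset_itvr; rewrite bnd_simp (le_lt_trans xb).
have lnba : ln (b / a) = 2 / k.
  by rewrite /a invfM mulrA divff ?gt_eqF// mul1r -expRN opprK expRK.
have := H e; rewrite in_itv /= (ltW e0)/=.
have -> : e <= Pi0 P0.
  have := @Pi0_ge y; rewrite (ltW y0) y1 -/p => /(_ isT); apply: le_trans.
  by rewrite /e mulrC ler_wpM2r// ?(ltW p0)//; lra.
move=> /(_ isT); rewrite /rho add0r => Hk.
have := ler_wpM2l (ltW k0) drop; rewrite lnba.
have -> : k * (e * (2 / k)) = 2 * e by field; rewrite gt_eqF.
lra.
Qed.

(** The left derivative of the objective exists because the level set is null.
    It shows [k * sale_log P0 s 1 >= 1], so the sale region is not empty, so
    [s < Pi0 P0], and then the right derivative is available too. *)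
Lemma argmin_first_order k s : 0 < s -> 0 < k -> is_argmin_rho P0 k s ->
  leb [set x : R | 0 < x < 1 /\ Pbar P0 x = s / x] = 0%E ->
  k * sale_log P0 s 1 = 1.
Proof.
move=> s0 k0 [+ H] null; rewrite in_itv /= => /andP[_ sPi].
have slope_k c : c != 0 -> `|c| <= s / 2 ->
  (fun n => k * ((c / n.+1%:R)^-1 * (shortfall P0 (equal_revenue s) -
     shortfall P0 (equal_revenue (s + c / n.+1%:R))))) @ \oo --> k * sale_log P0 s 1.
  by move=> c0 cs; apply: cvgM; [exact: cvg_cst|exact: slope_global].
have rho_le e : 0 < s + e -> s + e <= Pi0 P0 ->
    k * (shortfall P0 (equal_revenue s) - shortfall P0 (equal_revenue (s + e))) <= e.
  move=> se0 sePi; have := H (s + e); rewrite in_itv /= (ltW se0) sePi => /(_ isT).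
  by rewrite /rho !dpi_shortfall//; lra.
have inv_le1 n : n.+1%:R^-1 <= 1 :> R by rewrite invf_le1 ?ltr0n// ler1n.
have inv_gt0 n : 0 < n.+1%:R^-1 :> R by rewrite invr_gt0 ltr0n.
have lower : 1 <= k * sale_log P0 s 1.
  have cs : `|- (s / 2)| <= s / 2 by rewrite normrN ger0_norm// divr_ge0// ltW.
  have c0 : - (s / 2) != 0 by rewrite oppr_eq0 mulf_neq0 ?invr_neq0 ?gt_eqF.
  apply: (cvgr_to_ge (slope_k _ c0 cs)); apply: nearW => n.
  set e := - (s / 2) / _.
  have e0 : e < 0 by rewrite /e mulNr oppr_lt0 mulr_gt0// divr_gt0.
  have es : - (s / 2) <= e.
    by rewrite /e mulNr lerN2 ler_piMr// divr_ge0// ltW.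
  have := rho_le e ltac:(lra) ltac:(lra).
  rewrite mulrCA -[1](mulVf (ltr0_neq0 e0)) ler_nM2l ?invr_lt0//.
have L0 : 0 < sale_log P0 s 1.
  by rewrite -(pmulr_rgt0 _ k0); exact: lt_le_trans lower.
have sPi' : s < Pi0 P0.
  rewrite ltNge; apply/negP => Pis; move: L0; rewrite /sale_log.
  rewrite (@eq_Rintegral _ _ _ leb _ (cst 0)); first by rewrite Rintegral_itv_cst// mul0r ltxx.
  move=> x _; rewrite /sale_slope; case: ifPn => // h.
  have /andP[sx x1] := sale_region_gt P01 s0 h; have x0 := lt_trans s0 sx.
  have := @mul_Pbar_le_Pi0 x; rewrite (ltW x0) (ltW x1) => /(_ isT) h2.
  move: h; rewrite (equal_revenue_ge (ltW sx)) ltr_pdivrMr// mulrC => h.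
  by move: (lt_le_trans h h2); rewrite ltNge Pis.
apply/eqP; rewrite eq_le lower andbT.
pose c := Num.min (s / 2) (Pi0 P0 - s).
have c_gt0 : 0 < c by rewrite lt_min divr_gt0// subr_gt0.
have cs : `|c| <= s / 2 by rewrite ger0_norm ?(ltW c_gt0)// ge_min lexx.
apply: (cvgr_to_le (slope_k _ (lt0r_neq0 c_gt0) cs)); apply: nearW => n.
set e := c / _.
have e0 : 0 < e by rewrite mulr_gt0.
have ec : e <= Pi0 P0 - s.
  by apply: (@le_trans _ _ c); rewrite ?ler_piMr ?(ltW c_gt0)// ge_min lexx orbT.
have := rho_le e ltac:(lra) ltac:(lra).
by rewrite mulrCA -[1](mulVf (lt0r_neq0 e0)) ler_pM2l ?invr_gt0.
Qed.

(** Otherwise [d] would become negative just above [s], its slope there being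
    [- sale_log P0 s 1]. *)
Lemma dpi_gt0 s : 0 < s ->
  leb [set x : R | 0 < x < 1 /\ Pbar P0 x = s / x] = 0%E ->
  0 < sale_log P0 s 1 -> 0 < dpi P0 s.
Proof.
move=> s0 null L0.
have cs : `|s / 2| <= s / 2 by rewrite ger0_norm// divr_ge0// ltW.
have c0 : s / 2 != 0 by rewrite mulf_neq0 ?invr_neq0 ?gt_eqF.
have near_pos := cvgr_gt _ (slope_global P01 s0 null c0 cs) _ L0.
have [n] := filter_ex (near_pos _).
rewrite pmulr_rgt0 ?invr_gt0 ?divr_gt0// subr_gt0 dpi_shortfall//.
by apply: le_lt_trans; apply: Rintegral_ge0 => x _; rewrite le_max lexx orbT.
Qed.

End minimizer.

(** * The mechanism selling on the sale region *)

Lemma Rintegral_itv_finite_eq (R : realType) (f g : R -> R) (B : set R) (a b : R) :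
  finite_set B ->
  (@lebesgue_measure R).-integrable `[a, b]%classic (EFin \o f) ->
  (@lebesgue_measure R).-integrable `[a, b]%classic (EFin \o g) ->
  (forall x, a < x < b -> ~ B x -> f x = g x) ->
  Rintegral (@lebesgue_measure R) `[a, b]%classic f =
  Rintegral (@lebesgue_measure R) `[a, b]%classic g.
Proof.
move=> finB fi gi fg; congr fine; apply: ae_eq_integral => //.
- exact: measurable_int fi.
- exact: measurable_int gi.
- pose C := B `|` [set a] `|` [set b].
  have finC : finite_set C by rewrite !finite_setU; do !split => //; exact: finite_set1.
  apply: (@negligibleS _ _ _ (@lebesgue_measure R) C).
    move=> x /= H; apply: contrapT => xC; apply: H; rewrite in_itv /= => /andP[ax xb].
    congr EFin; apply: fg => [|xB]; last by apply: xC; left; left.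
    rewrite !lt_neqAle ax xb !andbT; apply/andP; split; apply/eqP => xe; apply: xC.
      by left; right; rewrite /= -xe.
    by right; rewrite /= xe.
  apply/negligibleP.
    apply: countable_measurable (finite_set_countable finC) => x; exact: measurable_set1.
  apply: countable_lebesgue_measure0; exact: finite_set_countable.
Qed.

Section sale_mechanism.
Context {R : realType}.
Notation leb := (@lebesgue_measure R).
Context (P0 : probability (measurableTypeR R) R).
Context (P01 : supported01 P0).
Context (s : R).
Context (s0 : 0 < s).
Implicit Types (t x y k : R) (q m : R -> R).

Notation slope := (sale_slope P0 s).
Notation slog := (sale_log P0 s).

Definition sale_ind x : R := if equal_revenue s x < Pbar P0 x then 1 else 0.

Definition sale_length t := Rintegral leb `[0, t]%classic sale_ind.

Lemma sale_ind01 x : 0 <= sale_ind x <= 1.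
Proof. by rewrite /sale_ind; case: ifP; rewrite ?lexx ler01. Qed.

Lemma sale_ind_measurable (D : set R) : measurable D -> measurable_fun D sale_ind.
Proof.
by move=> mD; apply: sale_region_if_measurable => //; exact: measurable_cst.
Qed.

Lemma sale_ind_integrable a b : leb.-integrable `[a, b]%classic (EFin \o sale_ind).
Proof.
apply: (@bounded_integrable_itv _ _ _ _ 1); first exact: sale_ind_measurable.
by move=> x _; have /andP[h1 h2] := sale_ind01 x; rewrite ger0_norm.
Qed.

Lemma sale_log_incr x y : 0 <= x -> x <= y ->
  slog y - slog x = Rintegral leb `[x, y]%classic slope.
Proof. by move=> *; apply: Rintegral_itv_split => //; exact: sale_slope_integrable. Qed.

Lemma sale_length_incr x y : 0 <= x -> x <= y ->
  sale_length y - sale_length x = Rintegral leb `[x, y]%classic sale_ind.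
Proof. by move=> *; apply: Rintegral_itv_split => //; exact: sale_ind_integrable. Qed.

Lemma sale_log0 : slog 0 = 0.
Proof. by rewrite /sale_log set_itv1 Rintegral_set1. Qed.

Lemma sale_length0 : sale_length 0 = 0.
Proof. by rewrite /sale_length set_itv1 Rintegral_set1. Qed.

Lemma sale_log_homo x y : 0 <= x -> x <= y -> slog x <= slog y.
Proof.
move=> x0 xy; rewrite -subr_ge0 sale_log_incr//; apply: Rintegral_ge0 => z _.
by have /andP[] := sale_slope_itv P01 z s0.
Qed.

Lemma sale_mechanism k : 0 < k -> k * slog 1 = 1 ->
  mechanism (fun v => k * slog v) (fun v => k * sale_length v).
Proof.
move=> k0 kL; apply/mechanismP; split.
- move=> v; rewrite in_itv /= => /andP[v0 v1].
  rewrite mulr_ge0 ?(ltW k0)//=; last by rewrite -sale_log0 sale_log_homo.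
  by rewrite -kL ler_wpM2l ?(ltW k0)// sale_log_homo.
- move=> x y; rewrite !in_itv /= => /andP[x0 _] _ xy.
  by rewrite ler_wpM2l ?(ltW k0)// sale_log_homo.
- by rewrite sale_length0 mulr0.
move=> x y x0 xy y1; rewrite -!mulrBr sale_log_incr// sale_length_incr//.
rewrite ![_ * (k * _)]mulrCA !ler_pM2l//.
rewrite -!RintegralZl//; try exact: sale_slope_integrable.
have ci c : leb.-integrable `[x, y]%classic (EFin \o (fun z => c * slope z)).
  exact: (integrableZl _ _ (sale_slope_integrable P01 s0 x y)).
apply/andP; split; apply: le_Rintegral => //; try exact: ci;
  try exact: sale_ind_integrable; move=> z /=; rewrite in_itv /= => /andP[xz zy];
  rewrite /sale_slope /sale_ind; case: ifPn => [/(sale_region_gt P01 s0)/andP[sz _]|_];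
  rewrite ?mulr0//; have z0 := lt_trans s0 sz.
- by rewrite ler_pdivrMr// mul1r.
- by rewrite ler_pdivlMr// mul1r.
Qed.

(** With [k * sale_log 1 = 1] the target is [k \int_A Pbar P0], where [A] is the
    sale region, while the revenue under [P] is [k \int_A Pbar P]. *)
Lemma sale_mechanism_feasible k : 0 < k -> k * slog 1 = 1 ->
  RS_feasible P0 (s + k * dpi P0 s) (fun v => k * slog v) (fun v => k * sale_length v) k.
Proof.
move=> k0 kL; split => //; first exact: sale_mechanism.
move=> P PS.
rewrite (@revenue_absolutely_continuous _ _ PS (fun x => k * sale_ind x) k); first last.
- by move=> v _; rewrite RintegralZl//; exact: sale_ind_integrable.
- move=> x _; have /andP[i0 i1] := sale_ind01 x.
  by rewrite mulr_ge0 ?(ltW k0)//= ler_piMr// ltW.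
- by apply: measurable_funM; [exact: measurable_cst|exact: sale_ind_measurable].
have i3 : leb.-integrable `[0, 1]%classic (EFin \o (fun x => sale_ind x * Pbar P x)).
  apply: (@bounded_integrable_itv _ _ _ _ 1).
    by apply: measurable_funM; [exact: sale_ind_measurable|exact: Pbar_measurable].
  move=> x _; have /andP[h0 h1] := sale_ind01 x.
  by rewrite ger0_norm ?mulr_ge0 ?Pbar_ge0// mulr_ile1 ?Pbar_ge0 ?Pbar_le1.
have -> : Rintegral leb `[0, 1]%classic (fun x => k * sale_ind x * Pbar P x) =
    k * Rintegral leb `[0, 1]%classic (fun x => sale_ind x * Pbar P x).
  by rewrite -RintegralZl//; apply: eq_Rintegral => x _; rewrite mulrA.
have sE : s = k * (s * slog 1) by rewrite mulrCA kL mulr1.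
rewrite {1}sE -mulrDr -mulrBr ler_pM2l//.
rewrite dpi_shortfall// /shortfall /dist /sale_log.
have i1 : leb.-integrable `[0, 1]%classic (EFin \o (fun x => s * slope x)).
  exact: (integrableZl _ _ (sale_slope_integrable P01 s0 0 1)).
have i2 : leb.-integrable `[0, 1]%classic
    (EFin \o (fun x => Num.max (Pbar P0 x - equal_revenue s x) 0)).
  apply: shortfall_integrable; first exact: equal_revenue_measurable.
  by move=> x; exact: equal_revenue_ge0.
have i4 : leb.-integrable `[0, 1]%classic (EFin \o (fun x => `|Pbar P x - Pbar P0 x|)).
  apply: (@bounded_integrable_itv _ _ _ _ 1).
    by apply: measurableT_comp => //; apply: measurable_funB; exact: Pbar_measurable.
  move=> x _; rewrite normr_id ler_norml.
  have := Pbar_ge0 P x; have := Pbar_le1 P x; have := Pbar_ge0 P0 x; have := Pbar_le1 P0 x.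
  by move=> *; apply/andP; split; lra.
rewrite -RintegralZl//; last exact: sale_slope_integrable.
have i12 : leb.-integrable `[0, 1]%classic
  (EFin \o (fun x => s * slope x + Num.max (Pbar P0 x - equal_revenue s x) 0)).
  exact: (integrableD _ i1 i2).
rewrite -RintegralD// -RintegralB//.
apply: le_Rintegral => //.
  exact: (integrableB _ i12 i3).
move=> x _; rewrite /sale_slope /sale_ind; case: ifPn => h.
  have /andP[sx _] := sale_region_gt P01 s0 h.
  rewrite max_l ?subr_ge0 ?(ltW h)// (equal_revenue_ge (ltW sx)) mul1r.
  rewrite [s / x + _]addrC subrK distrC; exact: ler_norm.
have h' : Pbar P0 x <= equal_revenue s x by rewrite leNgt.
by rewrite max_r ?subr_le0// mulr0 mul0r addr0 subr0 normr_ge0.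
Qed.

Lemma feasible_ext tau k q m q' m' :
  (forall v, 0 <= v <= 1 -> q v = q' v /\ m v = m' v) ->
  RS_feasible P0 tau q m k -> RS_feasible P0 tau q' m' k.
Proof.
move=> E [[q01 qh mE] k0 feas]; split => //.
  split=> [v v01|x y x01 y01 xy|v v01].
  - by have [<- _] := E v v01; exact: q01.
  - by have [<- _] := E x x01; have [<- _] := E y y01; exact: qh.
  - have [<- <-] := E v v01; rewrite mE//; congr (_ - _).
    apply: eq_Rintegral => x; rewrite inE /= in_itv /= => /andP[x0 xv].
    by move: v01; rewrite in_itv /= => /andP[_ v1]; 
      have [] := E x ltac:(by rewrite x0 (le_trans xv)).
move=> P /feas; congr (_ - _ <= _).
by apply: eq_Rintegral => x; rewrite inE /= in_itv /= => /E[].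
Qed.

Lemma optimal_unique k q m : k * slog 1 = 1 ->
  leb [set x : R | 0 < x < 1 /\ Pbar P0 x = s / x] = 0%E ->
  RS_feasible P0 (s + k * dpi P0 s) q m k ->
  forall v, 0 <= v <= 1 -> q v = k * slog v /\ m v = k * sale_length v.
Proof.
move=> kL null feas; have [[q01 qh mE] k0 _] := feas.
have qE v : 0 <= v <= 1 -> q v = k * slog v.
  move=> v01; apply/eqP; rewrite eq_le (optimal_ge P01 s0 null feas v01) andbT.
  by have := optimal_le P01 s0 null feas v01; rewrite mulrBr kL; lra.
move=> v v01; split; first exact: qE.
have [_ _ mE'] := sale_mechanism k0 kL.
rewrite mE// mE'// qE//; congr (_ - _).
apply: eq_Rintegral => x; rewrite inE /= in_itv /= => /andP[x0 xv].
by rewrite qE// x0 (le_trans xv)//; case/andP: v01.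
Qed.

End sale_mechanism.

(** * The sale region as a union of intervals *)

Section sale_intervals.
Context {R : realType}.
Notation leb := (@lebesgue_measure R).
Context (P0 : probability (measurableTypeR R) R).
Context (P01 : supported01 P0).
Context (s : R).
Context (s0 : 0 < s).
Context (J : nat) (u w : nat -> R).
Context (levels : level_intervals P0 s J u w).
Implicit Types (x y v : R) (j i : nat).

Notation slope := (sale_slope P0 s).
Notation slog := (sale_log P0 s).
Notation slen := (sale_length P0 s).
Let U := [set x : R | exists2 j : nat, (1 <= j <= J)%N & u j < x < w j].

Let region_iff x :
  (equal_revenue s x < Pbar P0 x) <-> (0 < x < 1 /\ Pbar P0 x > s / x).
Proof.
split=> [h|[/andP[x0 x1] h]].
  have /andP[sx x1] := sale_region_gt P01 s0 h; have x0 := lt_trans s0 sx.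
  by rewrite x0 x1; split => //; rewrite -equal_revenue_ge// ltW.
rewrite equal_revenue_ge// leNgt; apply/negP => xs.
have := lt_le_trans h (Pbar_le1 P0 x).
by rewrite ltr_pdivrMr// mul1r ltNge (ltW xs).
Qed.

(** Otherwise [Pbar P0] would exceed [1] near [0]. *)
Let u_gt0 j : (1 <= j <= J)%N -> 0 < u j.
Proof.
case: levels => Huw _ _ Hge Hj; have [u0 uw w1] := Huw j Hj.
rewrite lt_neqAle u0 andbT; apply/eqP => uj0.
pose x := Num.min (w j / 2) (s / 2); have wj0 : 0 < w j by rewrite uj0.
have x0 : 0 < x by rewrite lt_min !divr_gt0.
have := Hge j x Hj; rewrite -uj0 (ltW x0)/= => /(_ _)/wrap[].
  by rewrite gt_min; apply/orP; left; lra.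
apply/negP; rewrite -ltNge; apply: le_lt_trans (Pbar_le1 _ _) _.
by rewrite ltr_pdivlMr// mul1r gt_min; apply/orP; right; have s0' := s0; lra.
Qed.

Let chain i j : (1 <= i)%N -> (i < j <= J)%N -> w i < u j.
Proof.
case: levels => Huw Hwu _ _ i1; elim: j => [//|j IH] /andP[].
rewrite ltnS leq_eqVlt => /predU1P[<- iJ|ij jJ]; first by apply: Hwu; rewrite i1.
have j1 : (1 <= j)%N by rewrite (leq_trans i1)// ltnW.
have [_ uw _] := Huw j ltac:(by rewrite j1 ltnW).
apply: lt_trans (Hwu j ltac:(by rewrite j1)).
by apply: lt_trans uw; apply: IH; rewrite ij ltnW.
Qed.

Lemma sale_incr_inside j x y : (1 <= j <= J)%N -> u j <= x -> x <= y -> y <= w j ->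
  slog y - slog x = ln (y / x) /\ slen y - slen x = y - x.
Proof.
move=> Hj ux xy yw; have x0 := lt_le_trans (u_gt0 Hj) ux.
have [Huw _ fin _] := levels.
have reg z : x < z < y -> ~ (U `\` [set x | 0 < x < 1 /\ Pbar P0 x > s / x]) z ->
    equal_revenue s z < Pbar P0 z.
  move=> /andP[xz zy] H; apply/region_iff; apply: contrapT => K; apply: H; split => //.
  by exists j => //; rewrite (le_lt_trans ux xz) (lt_le_trans zy yw).
move: fin; rewrite finite_setU => -[_ finU].
rewrite sale_log_incr ?sale_length_incr ?(ltW x0)//; split.
  rewrite -Rintegral_inv//; apply: (Rintegral_itv_finite_eq finU).
  - exact: sale_slope_integrable.
  - exact: inv_integrable.
  - by move=> z zxy /(reg z zxy) h; rewrite /sale_slope h.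
rewrite -[RHS]mul1r -Rintegral_itv_cst//; apply: (Rintegral_itv_finite_eq finU).
- exact: sale_ind_integrable.
- by apply: (@bounded_integrable_itv _ _ _ _ `|1|) => //; exact: measurable_cst.
- by move=> z zxy /(reg z zxy) h; rewrite /sale_ind h.
Qed.

Lemma sale_incr_gap j x y : (j <= J)%N -> wext w j <= x -> x <= y ->
  y <= uext J u j.+1 -> slog y = slog x /\ slen y = slen x.
Proof.
move=> jJ wx xy yu; have [Huw Hwu fin _] := levels.
have x0 : 0 <= x.
  apply: le_trans wx; rewrite /wext; case: eqP => // /eqP; rewrite -lt0n => j0.
  by have [u0 uw _] := Huw j ltac:(by rewrite j0); rewrite (le_trans u0)// ltW.
have reg z : x < z < y -> ~ ([set x | 0 < x < 1 /\ Pbar P0 x > s / x] `\` U) z ->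
    (equal_revenue s z < Pbar P0 z) = false.
  move=> /andP[xz zy] H; apply/negP => /region_iff h; apply: H; split => // -[i /andP[i1 iJ]].
  move=> /andP[uz zw]; have wz := le_lt_trans wx xz; have zu := lt_le_trans zy yu.
  have [ij|ji] := leqP i j.
    move: wz; rewrite /wext; case: eqP => [j0|_]; first by move: ij; rewrite j0 leqNgt i1.
    move: ij; rewrite leq_eqVlt => /predU1P[<-|ij]; first by rewrite ltNge (ltW zw).
    have wu := chain i1 (j := j) ltac:(by rewrite ij).
    have [_ uw _] := Huw j ltac:(by rewrite jJ (leq_trans i1)// ltnW).
    by rewrite ltNge (ltW (lt_trans zw (lt_trans wu uw))).
  move: zu; rewrite /uext /= (leq_trans ji iJ) => zu.
  move: ji; rewrite leq_eqVlt => /predU1P[ji|ji].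
    by move: (lt_trans uz zu); rewrite -ji ltxx.
  have wu := chain (i := j.+1) (j := i) isT ltac:(by rewrite ji).
  have [_ uw _] := Huw j.+1 ltac:(by rewrite /= (leq_trans (ltnW ji))).
  by have := lt_trans (lt_trans uz zu) (lt_trans uw wu); rewrite ltxx.
move: fin; rewrite finite_setU => -[finA _].
have ci : leb.-integrable `[x, y]%classic (EFin \o cst (0 : R)).
  by apply: (@bounded_integrable_itv _ _ _ _ 0) => [|z _]; rewrite ?normr0//; exact: measurable_cst.
split; apply/eqP; rewrite -subr_eq0 ?sale_log_incr ?sale_length_incr//; apply/eqP.
  rewrite -[RHS](mul0r (y - x)) -Rintegral_itv_cst//.
  apply: (Rintegral_itv_finite_eq finA) => //; first exact: sale_slope_integrable.
  by move=> z zxy /(reg z zxy) h; rewrite /sale_slope h.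
rewrite -[RHS](mul0r (y - x)) -Rintegral_itv_cst//.
apply: (Rintegral_itv_finite_eq finA) => //; first exact: sale_ind_integrable.
by move=> z zxy /(reg z zxy) h; rewrite /sale_ind h.
Qed.

Lemma wext_le_uext j : (j <= J)%N -> wext w j <= uext J u j.+1.
Proof.
have [Huw Hwu _ _] := levels.
rewrite /wext /uext /= leq_eqVlt => /predU1P[->|jJ].
  rewrite ltnn; case: eqP => // /eqP; rewrite -lt0n => J0.
  by have [] := Huw J ltac:(by rewrite J0 leqnn).
rewrite jJ; case: eqP => [_|/eqP]; first by have [] := Huw j.+1 jJ.
by rewrite -lt0n => j0; rewrite ltW// Hwu// j0.
Qed.

Lemma ext01 j : (j <= J)%N -> [/\ 0 <= uext J u j, wext w j <= 1,
  0 <= wext w j & uext J u j.+1 <= 1].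
Proof.
have [Huw _ _ _] := levels => jJ.
have uext_le1 : uext J u j.+1 <= 1.
  rewrite /uext /=; case: ifP => // jJ'.
  by have [_ uw w1] := Huw j.+1 jJ'; rewrite (le_trans (ltW uw)).
have [j0|j0] := posnP j.
  by move: uext_le1; rewrite j0 {3}/uext /wext eqxx lexx ler01; split.
have [u0 uw w1] := Huw j ltac:(by rewrite j0).
by rewrite /uext /wext gtn_eqF// jJ u0 w1; split => //; rewrite (le_trans u0)// ltW.
Qed.

Lemma sale_wext j : (j <= J)%N ->
  slog (wext w j) = \sum_(1 <= i < j.+1) ln (w i / u i) /\
  slen (wext w j) = \sum_(1 <= i < j.+1) (w i - u i).
Proof.
elim: j => [_|j IH jJ].
  by rewrite /wext /= sale_log0 sale_length0 !big_geq.
have [l1 l2] := IH (ltnW jJ).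
have [g1 g2] := sale_incr_gap (ltnW jJ) (lexx _) (wext_le_uext (ltnW jJ)) (lexx _).
rewrite /uext /= jJ in g1 g2.
have [Huw _ _ _] := levels; have [_ uw _] := Huw j.+1 jJ.
have [i1 i2] := @sale_incr_inside j.+1 _ _ jJ (lexx _) (ltW uw) (lexx _).
rewrite !(@big_nat_recr _ _ _ j.+1)//= -l1 -l2 -i1 -i2 -g1 -g2 /wext /=.
by rewrite ![_ + (_ - _)]addrC !subrK.
Qed.

Lemma sale_uext j : (j < J)%N ->
  slog (u j.+1) = \sum_(1 <= i < j.+1) ln (w i / u i) /\
  slen (u j.+1) = \sum_(1 <= i < j.+1) (w i - u i).
Proof.
move=> jJ; have [<- <-] := sale_wext (ltnW jJ).
have := sale_incr_gap (ltnW jJ) (lexx _) (wext_le_uext (ltnW jJ)) (lexx _).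
by rewrite /uext /= jJ.
Qed.

Lemma sale_RS_form k : k * slog 1 = 1 ->
  RS_form k J u w (fun v => k * slog v) (fun v => k * slen v).
Proof.
move=> kL; split; last first.
  have u1 : uext J u J.+1 = 1 by rewrite /uext /= ltnn.
  have [_ w1 _ _] := ext01 (leqnn J).
  have [_ ->] := sale_incr_gap (leqnn J) (lexx _) w1 ltac:(by rewrite u1).
  by have [_ ->] := sale_wext (leqnn J); rewrite kL.
move=> j jJ; split=> v /andP[v1 v2]; last first.
  have [-> ->] := sale_incr_gap jJ (lexx _) v1 (ltW v2).
  by have [-> ->] := sale_wext jJ.
case: j jJ v1 v2 => [_|j jJ]; first by rewrite /uext /wext /= leNgt => /negP.
rewrite /uext /wext /= jJ => v1 v2.
have [i1 i2] := @sale_incr_inside j.+1 _ _ jJ (lexx _) v1 (ltW v2).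
have [<- <-] := sale_uext jJ.
by rewrite -i1 -i2 ![_ + (_ - _)]addrC !subrK.
Qed.

(** The half-open pieces cover [[0, 1[]: take the last [u_j] below [v]. *)
Lemma RS_form_unique k q m q' m' : RS_form k J u w q m -> RS_form k J u w q' m' ->
  forall v, 0 <= v <= 1 -> q v = q' v /\ m v = m' v.
Proof.
move=> [F E] [F' E'] v /andP[v0]; rewrite le_eqVlt => /predU1P[->|v1].
  by move: E E' => [-> ->] [-> ->].
have ex : exists j, (j <= J)%N && (uext J u j <= v) by exists 0%N; rewrite /uext eqxx v0.
have ub j : (j <= J)%N && (uext J u j <= v) -> (j <= J)%N by case/andP.
case: (ex_maxnP ex ub) => j /andP[jJ uv] jmax.
have vu : v < uext J u j.+1.
  rewrite ltNge; apply/negP => uv'; have [jJ'|] := leqP j.+1 J.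
    by have := jmax j.+1; rewrite jJ' uv' ltnn => /(_ isT).
  by move=> Jj; move: uv'; rewrite /uext /= leqNgt Jj /= leNgt v1.
have [[A B] [A' B']] := (F j jJ, F' j jJ).
have [vw|wv] := ltP v (wext w j).
  by have := A v; have := A' v; rewrite uv vw => /(_ isT)[-> ->] /(_ isT)[-> ->].
by have := B v; have := B' v; rewrite wv vu => /(_ isT)[-> ->] /(_ isT)[-> ->].
Qed.

Lemma RS_formP k q m : k * slog 1 = 1 -> RS_form k J u w q m <->
  forall v, 0 <= v <= 1 -> q v = k * slog v /\ m v = k * slen v.
Proof.
move=> kL; have F0 := sale_RS_form kL; split=> [F|E]; first exact: RS_form_unique F0.
have [F0a F0b] := F0; split; last by have [-> ->] := E 1 ltac:(by rewrite ler01 lexx).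
move=> j jJ; have [A B] := F0a j jJ; have [a1 a2 a3 a4] := ext01 jJ.
split=> v vv.
  have <- := A v vv; have /andP[v1 v2] := vv.
  by have [-> ->] := E v ltac:(by rewrite (le_trans a1 v1) (le_trans (ltW v2) a2)).
have <- := B v vv; have /andP[v1 v2] := vv.
by have [-> ->] := E v ltac:(by rewrite (le_trans a3 v1) (le_trans (ltW v2) a4)).
Qed.

End sale_intervals.

(** * The optimal mechanism *)

Theorem theorem2 (R : realType) (P0 : probability (measurableTypeR R) R)
    (hP0 : supported01 P0)
    (J : R -> nat) (u w : R -> nat -> R)
    (hlevel : forall pi : R, pi \in `[0, Pi0 P0] ->
       level_intervals P0 pi (J pi) (u pi) (w pi))
    (tau : R) (htau : 0 < tau <= Pi0 P0)
    (kRS : R) (hk : 0 < kRS) (hktau : rho_star P0 kRS = tau)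
    (pis : R) (hpis : is_argmin_rho P0 kRS pis)
    (hnull : @lebesgue_measure R
       [set x : R | 0 < x < 1 /\ Pbar P0 x = pis / x] = 0%E) :
  (exists q m : R -> R, RS_optimal P0 tau q m kRS) /\
  (forall (q m : R -> R) (k : R),
     RS_optimal P0 tau q m k <->
     k = kRS /\ RS_form kRS (J pis) (u pis) (w pis) q m).
Proof.
have Pi_gt0 : 0 < Pi0 P0 by case/andP: htau => /lt_le_trans; apply.
have s0 := argmin_gt0 Pi_gt0 hk hpis.
have kL := argmin_first_order hP0 s0 hk hpis hnull.
have [spi smin] := hpis; have lev := hlevel pis spi.
have L0 : 0 < sale_log P0 pis 1 by rewrite -(pmulr_rgt0 _ hk) kL.
have D0 := dpi_gt0 hP0 s0 hnull L0.
have tauE : tau = pis + kRS * dpi P0 pis.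
  rewrite -hktau /rho_star; apply/eqP; rewrite eq_le; apply/andP; split.
    apply: ge_inf; last by exists pis.
    by exists (rho P0 pis kRS) => _ [pi' pi'01 <-]; exact: smin.
  apply: lb_le_inf; first by exists (rho P0 pis kRS); exists pis.
  by move=> _ [pi' pi'01 <-]; exact: smin.
have kmin q m k : RS_feasible P0 tau q m k -> kRS <= k.
  move=> /(feasible_le hP0 s0); rewrite tauE lerD2l ler_pM2r//.
have feas := sale_mechanism_feasible hP0 s0 hk kL; rewrite -tauE in feas.
have opt : RS_optimal P0 tau (fun v => kRS * sale_log P0 pis v)
    (fun v => kRS * sale_length P0 pis v) kRS by split => // q m k; exact: kmin.
split; first by do 2 eexists; exact: opt.
move=> q m k; split=> [[fqm kopt]|[-> /(RS_formP hP0 s0 lev _ _ kL) E]].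
  have kE : k = kRS by apply/eqP; rewrite eq_le (kopt _ _ _ feas) (kmin _ _ _ fqm).
  split => //; apply/(RS_formP hP0 s0 lev _ _ kL); rewrite kE tauE in fqm.
  exact: optimal_unique.
split=> [|q' m' k']; last exact: kmin.
by apply: feasible_ext feas => v /E[-> ->].
Qed.
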